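(* Let $k\ge 1$ and let $\underline{T}=(T_1,\dots,T_k)$ be an anti-commuting $k$-tuple of non-zero contractions on $\mathbb{C}^2$. Then there exist a $q$-commuting tuple $\underline{U}=(U_1,\dots,U_k)$ of unitaries on a Hilbert space $\mathcal{K}\supseteq\mathbb{C}^2$ with $q\subseteq\{\pm1\}$ and a non-zero scalar $\beta\in\mathbb{C}$ such that $\underline{N}=(\beta U_1,U_2,\dots,U_k)$ dilates $\underline{T}$. Moreover: (1) If there is a non-zero non-invertible contraction among $T_1,\dots,T_k$, then $(T_1,\dots,T_k)$ dilates to a $q$-commuting tuple of unitaries with $q\subseteq\{\pm1\}$. (2) If $T_1,\dots,T_k$ are all invertible, then $k\le3$; and if $k=3$ and $\|T_1\|\le\|T_2T_3\|$, then $(T_1,T_2,T_3)$ dilates to an anti-commuting triple of unitaries.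
   Context: A tuple $(T_1,\dots,T_k)$ of operators on a Hilbert space is $q$-commuting, for a family $q=\{q_{ij}\in\mathbb{C}: |q_{ij}|=1,\ q_{ij}=q_{ji}^{-1},\ 1\le i<j\le k\}$, if $T_iT_j=q_{ij}T_jT_i$ for $1\le i<j\le k$; it is anti-commuting if $T_iT_j=-T_jT_i$ for $1\le i<j\le k$. The condition $q\subseteq\{\pm1\}$ means every $q_{ij}\in\{1,-1\}$. A contraction is an operator of norm at most $1$. A tuple $(N_1,\dots,N_k)$ of operators on a Hilbert space $\mathcal{K}$ dilates $(T_1,\dots,T_k)$ on $\mathcal{H}$ (equivalently, $(T_1,\dots,T_k)$ dilates to $(N_1,\dots,N_k)$) if there is an isometry $V:\mathcal{H}\to\mathcal{K}$ with $T_1^{m_1}\cdots T_k^{m_k}=V^*N_1^{m_1}\cdots N_k^{m_k}V$ for all non-negative integers $m_1,\dots,m_k$. *)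

(* Defs.v *)
From HB Require Import structures.
From mathcomp Require Import all_boot all_order all_algebra.
From mathcomp Require Import sesquilinear spectral complex.
From mathcomp Require Import all_classical all_reals all_analysis.
From mathcomp Require Import ring lra.

Set Implicit Arguments.
Unset Strict Implicit.
Unset Printing Implicit Defensive.

Import Order.TTheory GRing.Theory Num.Theory.
Import numFieldNormedType.Exports.

Local Open Scope ring_scope.
Local Open Scope classical_set_scope.

(* The norm of an inner product space, with values in R; the inner product
   [dot] is linear in its first argument, and [dot x x] is a nonnegative real. *)
Definition dot_norm (R : realType) (V : lmodType R[i])
    (dot : {dot V for Num.conj}) (x : V) : R :=
  Num.sqrt (complex.Re (dot x x)).

Definition norm_cauchy (R : realType) (V : zmodType) (nm : V -> R)
    (u : nat -> V) : Prop :=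
  forall e : R, 0 < e -> exists N : nat,
    forall m n : nat, (N <= m)%N -> (N <= n)%N -> nm (u m - u n) < e.

Definition norm_converges (R : realType) (V : zmodType) (nm : V -> R)
    (u : nat -> V) (l : V) : Prop :=
  forall e : R, 0 < e -> exists N : nat,
    forall n : nat, (N <= n)%N -> nm (u n - l) < e.

Record hilbert (R : realType) := Hilbert {
  hcarrier :> lmodType R[i];
  hdot : {dot hcarrier for Num.conj};
  hcomplete : forall u : nat -> hcarrier,
    norm_cauchy (dot_norm hdot) u ->
    exists l : hcarrier, norm_converges (dot_norm hdot) u l }.

Definition hnorm (R : realType) (H : hilbert R) (x : H) : R :=
  dot_norm (hdot H) x.

Lemma real_cauchy_converges (R : realType) (a : nat -> R) :
  norm_cauchy (fun x : R => `|x|) a ->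
  exists l : R, norm_converges (fun x : R => `|x|) a l.
Proof.
move=> ca.
have : cvgn a.
  apply/cauchy_cvgP/cauchy_exP => e e0.
  have [N HN] := ca e e0.
  exists (a N); exists N => // n /= Nn.
  by rewrite /ball /= HN.
move=> /cvgrPdist_lt cva.
exists (limn a) => e e0.
have [N _ HN] := cva e e0.
by exists N => n Nn; rewrite distrC; apply: HN.
Qed.

Lemma dotmx_norm2E (R : realType) (x : 'rV[R[i]]_2) :
  dot_norm (@dotmx R[i] 2) x =
  Num.sqrt (complex.Re (x 0 0) ^+ 2 + complex.Im (x 0 0) ^+ 2
          + (complex.Re (x 0 1) ^+ 2 + complex.Im (x 0 1) ^+ 2)).
Proof.
congr Num.sqrt; rewrite /= dotmxE mxE big_ord_recl big_ord1 !mxE.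
have -> : lift ord0 (ord0 : 'I_1) = 1 :> 'I_2 by apply/val_inj.
case: (x 0 0) => a b; case: (x 0 1) => c d /=; ring.
Qed.

Lemma C2_complete (R : realType) (u : nat -> 'rV[R[i]]_2) :
  norm_cauchy (dot_norm (@dotmx R[i] 2)) u ->
  exists l, norm_converges (dot_norm (@dotmx R[i] 2)) u l.
Proof.
move=> cu.
have sqle (p q : R) : 0 <= q -> p ^+ 2 <= q -> `|p| <= Num.sqrt q.
  by move=> q0 pq; rewrite -sqrtr_sqr ler_wsqrtr.
have coord (f : 'rV[R[i]]_2 -> R) :
    (forall x y, f (x - y) = f x - f y) ->
    (forall x, `|f x| <= dot_norm (@dotmx R[i] 2) x) ->
    exists l : R, norm_converges (fun x : R => `|x|) (f \o u) l.
  move=> fB fle; apply: real_cauchy_converges => e e0.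
  have [N HN] := cu e e0; exists N => m n Nm Nn /=.
  by rewrite -fB (le_lt_trans (fle _)) ?HN.
have ReB (x y : R[i]) : complex.Re (x - y) = complex.Re x - complex.Re y.
  by case: x; case: y.
have ImB (x y : R[i]) : complex.Im (x - y) = complex.Im x - complex.Im y.
  by case: x; case: y.
have [||a Ha] := coord (fun x => complex.Re (x 0 0)).
- by move=> x y; rewrite !mxE ReB.
- by move=> x; rewrite dotmx_norm2E sqle //; nra.
have [||b Hb] := coord (fun x => complex.Im (x 0 0)).
- by move=> x y; rewrite !mxE ImB.
- by move=> x; rewrite dotmx_norm2E sqle //; nra.
have [||c Hc] := coord (fun x => complex.Re (x 0 1)).
- by move=> x y; rewrite !mxE ReB.
- by move=> x; rewrite dotmx_norm2E sqle //; nra.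
have [||d Hd] := coord (fun x => complex.Im (x 0 1)).
- by move=> x y; rewrite !mxE ImB.
- by move=> x; rewrite dotmx_norm2E sqle //; nra.
exists (\row_j (if j == 0 then Complex a b else Complex c d)) => e e0.
have e2 : 0 < e / 2 by lra.
have [Na {}Ha] := Ha _ e2; have [Nb {}Hb] := Hb _ e2.
have [Nc {}Hc] := Hc _ e2; have [Nd {}Hd] := Hd _ e2.
exists (maxn (maxn Na Nb) (maxn Nc Nd)) => n.
rewrite !geq_max => /andP[/andP[na nb] /andP[nc nd]].
rewrite dotmx_norm2E !mxE /= !ReB !ImB /=.
have {}Ha := Ha _ na; have {}Hb := Hb _ nb.
have {}Hc := Hc _ nc; have {}Hd := Hd _ nd.
rewrite /= in Ha Hb Hc Hd.
have sqlt (p : R) : `|p| < e / 2 -> p ^+ 2 < (e / 2) ^+ 2.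
  by move=> h; rewrite -real_normK ?num_real// ltr_pXn2r// nnegrE ltW.
have {}Ha := sqlt _ Ha; have {}Hb := sqlt _ Hb.
have {}Hc := sqlt _ Hc; have {}Hd := sqlt _ Hd.
rewrite -[ltRHS](@ger0_norm _ e) ?ltW// -sqrtr_sqr ltr_sqrt ?exprn_gt0//.
have -> : e ^+ 2 = (e / 2) ^+ 2 + (e / 2) ^+ 2 + ((e / 2) ^+ 2 + (e / 2) ^+ 2).
  by field.
by rewrite !ltrD.
Qed.

Definition C2 (R : realType) : hilbert R :=
  @Hilbert R 'rV[R[i]]_2 (@dotmx R[i] 2) (@C2_complete R).

(* Linear maps; the ones in use below (maps on C^2, scalar multiples of
   unitaries, isometries) are automatically bounded. *)
Notation operator H := {linear hcarrier H -> hcarrier H}.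

(* The operator norm, which is +oo if T is not bounded. *)
Definition opnorm (R : realType) (H K : hilbert R) (T : H -> K) : \bar R :=
  ereal_sup [set (hnorm (T x))%:E | x in [set x : H | hnorm x <= 1]].

Definition contraction_op (R : realType) (H : hilbert R)
    (T : operator H) : Prop :=
  (opnorm T <= 1)%E.

Definition nonzero_op (R : realType) (H : hilbert R) (T : operator H) : Prop :=
  exists x : H, T x != 0.

Definition is_adjoint (R : realType) (H K : hilbert R)
    (T : H -> K) (Tstar : K -> H) : Prop :=
  forall (x : H) (y : K), hdot K (T x) y = hdot H x (Tstar y).

Definition hisometry (R : realType) (H K : hilbert R) (V : H -> K) : Prop :=
  forall x : H, hnorm (V x) = hnorm x.

Definition unitary_op (R : realType) (H : hilbert R) (U : operator H) : Prop :=
  exists Ustar : operator H,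
    [/\ is_adjoint U Ustar, cancel U Ustar & cancel Ustar U].

(* A family q_ij, i <> j; the diagonal values are irrelevant. *)
Definition unimodular_family (R : realType) (k : nat)
    (q : 'I_k -> 'I_k -> R[i]) : Prop :=
  forall i j : 'I_k, (i < j)%N -> `|q i j| = 1 /\ q i j = (q j i)^-1.

Definition sign_family (R : realType) (k : nat)
    (q : 'I_k -> 'I_k -> R[i]) : Prop :=
  forall i j : 'I_k, i != j -> q i j = 1 \/ q i j = -1.

Definition q_commuting (R : realType) (H : hilbert R) (k : nat)
    (q : 'I_k -> 'I_k -> R[i]) (T : 'I_k -> operator H) : Prop :=
  unimodular_family q /\
  forall i j : 'I_k, (i < j)%N ->
    forall x : H, T i (T j x) = q i j *: T j (T i x).

Definition anti_commuting (R : realType) (H : hilbert R) (k : nat)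
    (T : 'I_k -> operator H) : Prop :=
  forall i j : 'I_k, (i < j)%N -> forall x : H, T i (T j x) = - T j (T i x).

(* T_1^{m_1} ... T_k^{m_k}; the factor of least index is applied last. *)
Definition op_monomial (R : realType) (H : hilbert R) (k : nat)
    (T : 'I_k -> operator H) (m : 'I_k -> nat) : H -> H :=
  \big[comp/id]_(i < k) iter (m i) (T i).

Definition dilates (R : realType) (H K : hilbert R) (k : nat)
    (N : 'I_k -> operator K) (T : 'I_k -> operator H) : Prop :=
  exists (V : {linear H -> K}) (Vstar : {linear K -> H}),
    [/\ hisometry V, is_adjoint V Vstar &
      forall (m : 'I_k -> nat) (x : H),
        op_monomial T m x = Vstar (op_monomial N m (V x))].

Definition scale_first (R : realType) (H : hilbert R) (k : nat)
    (beta : R[i]) (U : 'I_k -> operator H) : 'I_k -> operator H :=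
  fun i => if i == 0%N :> nat then (beta \*: U i : {linear H -> H}) else U i.

(* Main.v *)
(* Two anti-commuting contractions T1, T2 of C^2 have a traceless product T, so T^2 is a
   scalar d with |d| <= 1. If |d| = 1, then T1 and T2 are already unitary. Otherwise T^n -> 0,
   and a signed version of the Berger-Coburn-Lebow model of Ando's dilation provides
   explicit anti-commuting unitaries on l^2(Z; C^2 + C^2).
   For k <= 2 this is enough, a single contraction being paired with 0. For k >= 3
   the identity tr(M) N + tr(N) M = tr(M) tr(N) makes all T_i traceless. If they are all
   invertible, then k = 3 and T1 = c T2 T3, and c is dilated separately, by a bilateral
   shift when |c| < 1. If some T_i is singular, then all of them except possibly one are
   multiples c_i E of the same E with E^2 = 0; since only the first power of c_i matters, it is
   enough to write c_i as the mean of two unimodular numbers. *)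

From HB Require Import structures.
Require Import Defs.
From mathcomp Require Import all_boot all_order all_algebra.
From mathcomp Require Import sesquilinear spectral complex.
From mathcomp Require Import finmap all_classical all_reals all_analysis.
From mathcomp Require Import ring lra.

Set Implicit Arguments.
Unset Strict Implicit.
Unset Printing Implicit Defensive.

Import Order.TTheory GRing.Theory Num.Theory.
Import numFieldNormedType.Exports.

Local Open Scope ring_scope.

(** * Inner products and unitaries *)

Local Notation Re := complex.Re.
Local Notation Im := complex.Im.

(** The dilations are stacked: a pair is dilated first, on a space K, and the scalars are then
    dilated on square-summable families with values in K. The signs on l^2(Z; E) come from T = T1 T2
    anti-commuting with each factor: T^m T1 = (-1)^m T1 T^m, so the n-th coordinate of a model
    operator has to carry (-1)^n. A scalar beta other than 1 arises in one place only. In an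
    invertible triple T1 = c T2 T3, the modulus of c can exceed 1 because T2 T3 may be much smaller
    than T1; the norm condition in (2) is what gives |c| <= 1. With a singular member, the signs
    q_ij are genuinely mixed. The multiples c_i E satisfy c_i E c_l E = 0, so they commute as well
    as anti-commute, and their dilations are chosen as phases times one unitary, which commute. No
    joint dilation of the c_i as scalars is needed: a monomial containing two of the c_i E
    vanishes. *)

Lemma eqC (R : realType) (x y : R[i]) : Re x = Re y -> Im x = Im y -> x = y.
Proof. by case: x y => a b [c d] /= -> ->. Qed.

Lemma ReD (R : realType) (x y : R[i]) : Re (x + y) = Re x + Re y.
Proof. by case: x; case: y. Qed.
Lemma ImD (R : realType) (x y : R[i]) : Im (x + y) = Im x + Im y.
Proof. by case: x; case: y. Qed.
Lemma ReN (R : realType) (x : R[i]) : Re (- x) = - Re x.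
Proof. by case: x. Qed.
Lemma ImN (R : realType) (x : R[i]) : Im (- x) = - Im x.
Proof. by case: x. Qed.

Lemma ReM (R : realType) (x y : R[i]) : Re (x * y) = Re x * Re y - Im x * Im y.
Proof. by case: x; case: y. Qed.
Lemma ImM (R : realType) (x y : R[i]) : Im (x * y) = Re x * Im y + Im x * Re y.
Proof. by case: x; case: y => a b c d /=; ring. Qed.
Lemma Re_conj (R : realType) (x : R[i]) : Re (Num.conj x) = Re x.
Proof. by case: x. Qed.
Lemma Im_conj (R : realType) (x : R[i]) : Im (Num.conj x) = - Im x.
Proof. by case: x. Qed.

Definition ReImE := (ReD, ImD, ReN, ImN, ReM, ImM, Re_conj, Im_conj).

(** Squared moduli, like the squared norms [nsq] below, take values in R rather than R[i], so that
    estimates stay within reach of [lra] and [nra]. *)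
Definition abs2 (R : realType) (x : R[i]) : R := Re x ^+ 2 + Im x ^+ 2.

Lemma abs2E (R : realType) (x : R[i]) : x * Num.conj x = (abs2 x)%:C%C.
Proof. by apply: eqC; rewrite !ReImE /abs2 /=; ring. Qed.

Lemma abs2M (R : realType) (x y : R[i]) : abs2 (x * y) = abs2 x * abs2 y.
Proof. by rewrite /abs2 !ReImE; ring. Qed.

Lemma abs2_ge0 (R : realType) (x : R[i]) : 0 <= abs2 x.
Proof. by rewrite addr_ge0 ?sqr_ge0. Qed.

Lemma abs2_eq0 (R : realType) (x : R[i]) : abs2 x = 0 -> x = 0.
Proof.
move=> /eqP; rewrite paddr_eq0 ?sqr_ge0// !sqrf_eq0 => /andP[/eqP a /eqP b].
exact: eqC.
Qed.

Section InnerProduct.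
Variables (R : realType) (H : hilbert R).
Implicit Types x y z : H.

Definition ip x y : R[i] := hdot H x y.
Definition nsq x : R := Re (ip x x).

Lemma ipDl x y z : ip (x + y) z = ip x z + ip y z.
Proof. exact: linearDl. Qed.
Lemma ipDr x y z : ip x (y + z) = ip x y + ip x z.
Proof. exact: linearDr. Qed.
Lemma ipNl x y : ip (- x) y = - ip x y.
Proof. exact: linearNl. Qed.
Lemma ipNr x y : ip x (- y) = - ip x y.
Proof. exact: linearNr. Qed.
Lemma ip0l x : ip 0 x = 0.
Proof. exact: linear0l. Qed.
Lemma ip0r x : ip x 0 = 0.
Proof. exact: linear0r. Qed.
Lemma ipZl a x y : ip (a *: x) y = a * ip x y.
Proof. exact: linearZl_LR. Qed.
Lemma ipZr a x y : ip x (a *: y) = Num.conj a * ip x y.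
Proof. exact: linearZr_LR. Qed.
Lemma ipC x y : ip y x = Num.conj (ip x y).
Proof. by rewrite /ip hermC expr0 mul1r. Qed.

Definition ipE := (ipDl, ipDr, ipNl, ipNr, ipZl, ipZr, ip0l, ip0r).

Lemma ipxx x : ip x x = (nsq x)%:C%C.
Proof.
apply: eqC => //=; have /(congr1 (@complex.Im R)) := ipC x x.
by rewrite Im_conj /=; lra.
Qed.

Lemma nsq_ge0 x : 0 <= nsq x.
Proof. by have := dnorm_ge0 (hdot H) x; rewrite -/(ip x x) ipxx ler0c. Qed.

Lemma nsq_eq0 x : nsq x = 0 -> x = 0.
Proof.
by move=> x0; apply/eqP; rewrite -(dnorm_eq0 (hdot H)) -/(ip x x) ipxx x0.
Qed.

Lemma nsq0 : nsq 0 = 0.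
Proof. by rewrite /nsq ip0l. Qed.

Lemma nsqZ a x : nsq (a *: x) = abs2 a * nsq x.
Proof. by rewrite /nsq !ipE ipxx /abs2 !ReImE /=; ring. Qed.

Lemma nsqN x : nsq (- x) = nsq x.
Proof. by rewrite /nsq !ipE opprK. Qed.

Lemma nsqD x y : nsq (x + y) = nsq x + nsq y + 2 * Re (ip x y).
Proof. by rewrite /nsq !ipE !ReD (ipC x y) Re_conj; ring. Qed.

Lemma nsqB x y : nsq (x - y) = nsq x + nsq y - 2 * Re (ip x y).
Proof. by rewrite nsqD nsqN ipNr ReN; ring. Qed.

Lemma nsqD_le x y : nsq (x + y) <= 2 * nsq x + 2 * nsq y.
Proof. by have := nsq_ge0 (x - y); rewrite nsqB nsqD; lra. Qed.

(** A weak substitute for Cauchy-Schwarz, read off from |x + y|^2 >= 0 and |x - y|^2 >= 0; the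
    absolute convergence of the inner product of l^2 needs no more. *)
Lemma Re_ip_le x y : `|Re (ip x y)| <= nsq x + nsq y.
Proof.
have := nsq_ge0 (x - y); have := nsq_ge0 (x + y); rewrite nsqB nsqD.
by have := nsq_ge0 x; have := nsq_ge0 y; rewrite ler_norml; lra.
Qed.

Lemma Im_ip_le x y : `|Im (ip x y)| <= nsq x + nsq y.
Proof.
have := Re_ip_le x ('i%C *: y).
by rewrite nsqZ ipZr !ReImE /abs2 /=; congr (`|_| <= _); ring.
Qed.

Lemma hnormE x : hnorm x = Num.sqrt (nsq x).
Proof. by []. Qed.

End InnerProduct.

Lemma ip_polar (R : realType) (X : lmodType R[i]) (H K : hilbert R)
    (f : {linear X -> H}) (g : {linear X -> K}) :
  (forall x, nsq (f x) = nsq (g x)) -> forall x y, ip (f x) (f y) = ip (g x) (g y).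
Proof.
move=> fg x y.
have re u v : Re (ip (f u) (f v)) = Re (ip (g u) (g v)).
  by have := fg (u + v); rewrite !linearD !nsqD !fg; lra.
apply: eqC => //; have := re x ('i%C *: y).
by rewrite !linearZ /= !ipZr !ReImE /=; lra.
Qed.

Lemma hisometryP (R : realType) (H K : hilbert R) (V : H -> K) :
  (forall x, nsq (V x) = nsq x) -> hisometry V.
Proof. by move=> VE x; rewrite !hnormE VE. Qed.

Lemma mk_linear (R : realType) (X Y : lmodType R[i]) (f : X -> Y) :
  (forall a x y, f (a *: x + y) = a *: f x + f y) ->
  {g : {linear X -> Y} | forall x, g x = f x}.
Proof.
move=> fl.
pose F := GRing.isLinear.Build _ _ _ _ f fl.
pose g : {linear X -> Y} := HB.pack f F.
by exists g.
Qed.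

Lemma unitary_opP (R : realType) (K : hilbert R) (U U' : operator K) :
  (forall x, nsq (U x) = nsq x) -> cancel U U' -> cancel U' U -> unitary_op U.
Proof.
move=> UE UK U'K; exists U'; split=> // x y.
have := ip_polar (f := U) (g := idfun) UE x (U' y).
by rewrite U'K.
Qed.

Lemma unitary_nsq (R : realType) (K : hilbert R) (U : operator K) :
  unitary_op U -> forall x, nsq (U x) = nsq x.
Proof. by move=> [V [adj UK _]] x; rewrite /nsq /ip adj UK. Qed.

Lemma unitary_inv (R : realType) (K : hilbert R) (U : operator K) :
  unitary_op U ->
  exists V : operator K, [/\ cancel U V, cancel V U, unitary_op V &
    forall x, nsq (V x) = nsq x].
Proof.
move=> Uu; have [V [adj UK VK]] := Uu; exists V.
have VE x : nsq (V x) = nsq x by rewrite -(unitary_nsq Uu) VK.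
by split=> //; apply: unitary_opP VE VK UK.
Qed.

Lemma unitary_comp (R : realType) (K : hilbert R) (U W X : operator K) :
  unitary_op U -> unitary_op W -> (forall x, X x = U (W x)) -> unitary_op X.
Proof.
move=> Uu Wu XE; have [U' [UK U'K _ _]] := unitary_inv Uu.
have [W' [WK W'K _ _]] := unitary_inv Wu.
apply: (@unitary_opP _ _ X (W' \o U')).
- by move=> x; rewrite XE !unitary_nsq.
- by move=> x /=; rewrite XE UK WK.
- by move=> x /=; rewrite XE W'K U'K.
Qed.

(** * The Hilbert space of square-summable families *)

Section Sums.
Variables (R : realType) (I : choiceType).
Implicit Types a b p n : I -> R.

(* Meaningful for nonnegative families only. *)
Definition tsum p : \bar R := \esum_(i in [set: I]) (p i)%:E.

Lemma tsum_ge0 p : (forall i, 0 <= p i) -> (0 <= tsum p)%E.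
Proof. by move=> p0; apply: esum_ge0 => i _; rewrite lee_fin. Qed.

Lemma eq_tsum p n : (forall i, p i = n i) -> tsum p = tsum n.
Proof. by move=> pn; apply: eq_esum => i _; rewrite pn. Qed.

Lemma le_tsum p n : (forall i, p i <= n i) -> (tsum p <= tsum n)%E.
Proof. by move=> pn; apply: le_esum => i _; rewrite lee_fin. Qed.

Lemma tsumD p n : (forall i, 0 <= p i) -> (forall i, 0 <= n i) ->
  tsum (fun i => p i + n i) = (tsum p + tsum n)%E.
Proof. by move=> p0 n0; rewrite -esumD// => i _; rewrite lee_fin. Qed.

Lemma tsumZ p (c : R) : 0 <= c -> (forall i, 0 <= p i) ->
  tsum (fun i => c * p i) = (c%:E * tsum p)%E.
Proof.
move=> c0 p0; rewrite /tsum /esum -ereal_supZl//; last first.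
  by apply/set0P; exists (\sum_(i \in set0) (p i)%:E)%E, set0 => //; exact: fsets_set0.
rewrite image_comp; congr ereal_sup; apply: eq_imagel => X _.
under eq_fsbigr do rewrite EFinM.
by rewrite -ge0_mule_fsumr// => i; rewrite lee_fin.
Qed.

Lemma tsum0 : tsum (fun=> 0) = 0%E.
Proof. exact: esum1. Qed.

Lemma le_term_tsum p i : (forall i, 0 <= p i) -> ((p i)%:E <= tsum p)%E.
Proof.
move=> p0; apply: esum_ge; exists [set i]%classic; first by split.
by rewrite fsbig_set1.
Qed.

Definition psum p : R := fine (tsum p).

Lemma psumE p : (forall i, 0 <= p i) -> (tsum p < +oo)%E -> tsum p = (psum p)%:E.
Proof. by move=> p0 pf; rewrite fineK// ge0_fin_numE ?tsum_ge0. Qed.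

Lemma psum_ge0 p : (forall i, 0 <= p i) -> 0 <= psum p.
Proof. by move=> p0; rewrite fine_ge0 ?tsum_ge0. Qed.

Lemma eq_psum p n : (forall i, p i = n i) -> psum p = psum n.
Proof. by move=> /eq_tsum pn; rewrite /psum pn. Qed.

Definition summ a : Prop := (tsum (fun i => `|a i|%R) < +oo)%E.

Lemma le_summ a b : (forall i, `|a i| <= `|b i|) -> summ b -> summ a.
Proof. by move=> ab; apply: le_lt_trans; apply: le_tsum. Qed.

Lemma summD a b : summ a -> summ b -> summ (fun i => a i + b i).
Proof.
move=> sa sb; apply: (@le_lt_trans _ _ (tsum (fun i => `|a i| + `|b i|)%R)).
  by apply: le_tsum => i; apply: ler_normD.
by rewrite tsumD// lte_add_pinfty.
Qed.

Lemma summZ c a : summ a -> summ (fun i => c * a i).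
Proof.
move=> sa; rewrite /summ (@eq_tsum _ (fun i => `|c| * `|a i|)); last first.
  by move=> i; rewrite normrM.
by rewrite tsumZ// lte_mul_pinfty.
Qed.

Lemma summN a : summ a -> summ (fun i => - a i).
Proof. by apply: le_summ => i; rewrite normrN. Qed.

Lemma summP p : (forall i, 0 <= p i) -> summ p <-> (tsum p < +oo)%E.
Proof.
by move=> p0; rewrite /summ (@eq_tsum (fun i => `|p i|) p)// => i; rewrite ger0_norm.
Qed.

Definition rsum a : R :=
  psum (fun i => Num.max (a i) 0) - psum (fun i => Num.max (- a i) 0).

Lemma summ_max a : summ a -> summ (fun i => Num.max (a i) 0).
Proof.
apply: le_summ => i; rewrite ger0_norm ?le_max ?lexx ?orbT//.
by rewrite ge_max ler_norm normr_ge0.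
Qed.

Lemma psumD p n : (forall i, 0 <= p i) -> (forall i, 0 <= n i) -> summ p -> summ n ->
  psum (fun i => p i + n i) = psum p + psum n.
Proof.
move=> p0 n0 /summP-/(_ p0) sp /summP-/(_ n0) sn.
by rewrite /psum tsumD// fineD// ge0_fin_numE// tsum_ge0.
Qed.

Lemma psumZ p (c : R) : 0 <= c -> (forall i, 0 <= p i) -> summ p ->
  psum (fun i => c * p i) = c * psum p.
Proof.
move=> c0 p0 /summP-/(_ p0) sp.
by rewrite {1}/psum tsumZ// psumE.
Qed.

(** From p - n = a^+ - a^- follows p + a^- = n + a^+, an identity between nonnegative families,
    where sums are additive. Linearity of [rsum] reduces to this independence of the
    decomposition. *)
Lemma rsum_split a p n : (forall i, 0 <= p i) -> (forall i, 0 <= n i) ->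
  summ p -> summ n -> (forall i, a i = p i - n i) -> rsum a = psum p - psum n.
Proof.
move=> p0 n0 sp sn apn.
have sa : summ a.
  apply: (@le_summ _ (fun i => p i + - n i)); first by move=> i; rewrite apn.
  by apply: summD => //; apply: summN.
pose m b i := Num.max (b i) (0 : R).
have m0 b i : 0 <= m b i by rewrite le_max lexx orbT.
have e : psum (m a) + psum n = psum p + psum (m (fun i => - a i)).
  rewrite -!psumD//; first last.
  - exact: (summ_max sa).
  - exact: (summ_max (summN sa)).
  apply: eq_psum => i; rewrite /m apn.
  by case: (lerP (p i - n i) 0) => h; case: (lerP (- (p i - n i)) 0) => h'; lra.
by rewrite /rsum -/(m a) -/(m (fun i => - a i)); move: e; lra.
Qed.

Lemma rsum_psum p : (forall i, 0 <= p i) -> summ p -> rsum p = psum p.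
Proof.
move=> p0 sp; rewrite (@rsum_split p p (fun=> 0))// => [||i].
- by rewrite {2}/psum tsum0 subr0.
- by rewrite /summ (@eq_tsum _ (fun=> 0)) ?tsum0// => i; rewrite normr0.
- by rewrite subr0.
Qed.

Lemma rsumD a b : summ a -> summ b -> rsum (fun i => a i + b i) = rsum a + rsum b.
Proof.
move=> sa sb; pose m b i := Num.max (b i) (0 : R).
have m0 c i : 0 <= m c i by rewrite le_max lexx orbT.
pose N (c : I -> R) i := - c i.
rewrite (@rsum_split _ (fun i => m a i + m b i) (fun i => m (N a) i + m (N b) i)).
- rewrite !psumD//; try by [exact: (summ_max sa)|exact: (summ_max sb)|
    exact: (summ_max (summN sa))|exact: (summ_max (summN sb))].
  by rewrite /rsum -/(m a) -/(m b) -/(m (N a)) -/(m (N b)); lra.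
- by move=> i; rewrite addr_ge0.
- by move=> i; rewrite addr_ge0.
- by apply: summD; [exact: (summ_max sa)|exact: (summ_max sb)].
- by apply: summD; [exact: (summ_max (summN sa))|exact: (summ_max (summN sb))].
- move=> i; rewrite /m /N.
  by case: (lerP (a i) 0); case: (lerP (b i) 0); case: (lerP (- a i) 0);
    case: (lerP (- b i) 0); lra.
Qed.

Lemma rsumN a : rsum (fun i => - a i) = - rsum a.
Proof.
rewrite /rsum opprB; congr (_ - _); apply: eq_psum => i.
by rewrite opprK.
Qed.

Lemma eq_rsum a b : (forall i, a i = b i) -> rsum a = rsum b.
Proof. by move=> ab; have -> : a = b by apply/funext. Qed.

Lemma rsumZ c a : summ a -> rsum (fun i => c * a i) = c * rsum a.
Proof.
wlog c0 : c / 0 <= c => [hw sa|sa].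
  have [c0|c0] := leP 0 c; first exact: hw.
  rewrite (@eq_rsum _ (fun i => - (- c * a i))); last by move=> i; ring.
  by rewrite rsumN hw ?oppr_ge0 ?ltW//; ring.
pose m b i := Num.max (b i) (0 : R).
have m0 b i : 0 <= m b i by rewrite le_max lexx orbT.
pose N (c : I -> R) i := - c i.
rewrite (@rsum_split _ (fun i => c * m a i) (fun i => c * m (N a) i)).
- rewrite !psumZ//; try by [exact: (summ_max sa)|exact: (summ_max (summN sa))].
  by rewrite /rsum -/(m a) -/(m (N a)); lra.
- by move=> i; rewrite mulr_ge0.
- by move=> i; rewrite mulr_ge0.
- by apply: summZ; exact: (summ_max sa).
- by apply: summZ; exact: (summ_max (summN sa)).
- move=> i; rewrite /m /N -mulrBr; congr (_ * _).
  by case: (lerP (a i) 0); case: (lerP (- a i) 0); lra.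
Qed.

Lemma rsum_lin c d a b e : summ a -> summ b -> summ e ->
  rsum (fun i => c * a i + d * b i + e i) = c * rsum a + d * rsum b + rsum e.
Proof.
move=> sa sb se; rewrite (rsumD (summD (summZ c sa) (summZ d sb)) se).
by rewrite (rsumD (summZ c sa) (summZ d sb)) !rsumZ.
Qed.
End Sums.

Section SquareSummable.
Variables (R : realType) (I : choiceType) (H : hilbert R).

Definition sqsumm : {pred I -> H} := fun f => `[<summ (fun i => nsq (f i))>].

Lemma sqsummP (f : I -> H) : reflect (summ (fun i => nsq (f i))) (f \in sqsumm).
Proof. exact: asboolP. Qed.

Lemma sqsumm_submod : submod_closed sqsumm.
Proof.
split=> [|a f g /sqsummP sf /sqsummP sg]; apply/sqsummP.
  rewrite /summ (@eq_tsum _ _ _ (fun=> 0)) ?tsum0// => i.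
  by rewrite nsq0 normr0.
apply: (@le_summ _ _ _ (fun i => 2 * abs2 a * nsq (f i) + 2 * nsq (g i))).
  move=> i; rewrite !ger0_norm ?addr_ge0 ?mulr_ge0 ?nsq_ge0 ?abs2_ge0//.
  by have := nsqD_le (a *: f i) (g i); rewrite nsqZ mulrA.
by apply: summD; apply: summZ.
Qed.

HB.instance Definition _ :=
  GRing.isSubmodClosed.Build R[i] (I -> H) sqsumm sqsumm_submod.

Record l2 := L2 { l2v :> I -> H; l2P : l2v \in sqsumm }.

HB.instance Definition _ := [isSub for l2v].
HB.instance Definition _ := [Choice of l2 by <:].
HB.instance Definition _ := [SubChoice_isSubLmodule of l2 by <:].

Implicit Types f g : l2.

Lemma l2BE f g i : (f - g) i = f i - g i.
Proof. by []. Qed.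

Lemma l2_inj f g : (forall i, f i = g i) -> f = g.
Proof. by move=> fg; apply/val_inj/funext. Qed.

Lemma l2_summ f : summ (fun i => nsq (f i)).
Proof. exact/sqsummP/l2P. Qed.

Definition l2dot f g : R[i] :=
  Complex (rsum (fun i => Re (ip (f i) (g i)))) (rsum (fun i => Im (ip (f i) (g i)))).

Lemma summ_Re f g : summ (fun i => Re (ip (f i) (g i))).
Proof.
apply: le_summ (summD (l2_summ f) (l2_summ g)) => i.
by rewrite (ger0_norm (addr_ge0 _ _)) ?nsq_ge0 ?Re_ip_le.
Qed.

Lemma summ_Im f g : summ (fun i => Im (ip (f i) (g i))).
Proof.
apply: le_summ (summD (l2_summ f) (l2_summ g)) => i.
by rewrite (ger0_norm (addr_ge0 _ _)) ?nsq_ge0 ?Im_ip_le.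
Qed.

Lemma l2dot_linl g a f f' : l2dot (a *: f + f') g = a * l2dot f g + l2dot f' g.
Proof.
apply: eqC; rewrite !ReImE /=.
  rewrite -mulNr -(rsum_lin _ _ (summ_Re f g) (summ_Im f g) (summ_Re f' g)).
  by apply: eq_rsum => i; rewrite !ipE !ReImE; ring.
rewrite -(rsum_lin _ _ (summ_Im f g) (summ_Re f g) (summ_Im f' g)).
by apply: eq_rsum => i; rewrite !ipE !ReImE; ring.
Qed.

Lemma l2dotC f g : l2dot f g = (-1) ^+ false * Num.conj (l2dot g f).
Proof.
rewrite expr0 mul1r; apply: eqC; rewrite !ReImE /=.
  by apply: eq_rsum => i; rewrite ipC Re_conj.
by rewrite -rsumN; apply: eq_rsum => i; rewrite ipC Im_conj.
Qed.

Lemma l2dot_linr f a g g' :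
  l2dot f (a *: g + g') = Num.conj a * l2dot f g + l2dot f g'.
Proof.
by rewrite l2dotC l2dot_linl !(l2dotC f) !expr0 !mul1r rmorphD rmorphM.
Qed.

Lemma l2dot_bilinear : bilinear_for *%R (Num.conj \; *%R) l2dot.
Proof. by split=> [g a f f'|f a g g'] /=; [exact: l2dot_linl|exact: l2dot_linr]. Qed.

HB.instance Definition _ := bilinear_isBilinear.Build R[i] l2 l2 R[i]
  *%R (Num.conj \; *%R) l2dot l2dot_bilinear.
HB.instance Definition _ :=
  isHermitianSesquilinear.Build R[i] l2 false Num.conj l2dot l2dotC.

Lemma l2dotxx f : l2dot f f = (psum (fun i => nsq (f i)))%:C%C.
Proof.
apply: eqC => /=.
  by rewrite rsum_psum//; [move=> i; exact: nsq_ge0|exact: l2_summ].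
have -> : (fun i => Im (ip (f i) (f i))) = (fun=> 0).
  by apply/funext => i; rewrite ipxx.
by rewrite (@rsum_psum _ _ (fun=> 0))//; [rewrite /psum tsum0|
  rewrite /summ (@eq_tsum _ _ _ (fun=> 0)) ?tsum0// => i; rewrite normr0].
Qed.

Lemma psum_ge_term f i : nsq (f i) <= psum (fun i => nsq (f i)).
Proof.
have f0 j : 0 <= nsq (f j) := nsq_ge0 _.
rewrite -lee_fin -psumE//; first exact: (le_term_tsum i f0).
exact/(summP f0)/l2_summ.
Qed.

Lemma l2dot_gt0 f : f != 0 -> 0 < l2dot f f.
Proof.
rewrite l2dotxx ltcR => f0; rewrite lt_neqAle psum_ge0 ?andbT; last first.
  by move=> i; exact: nsq_ge0.
apply/negP => /eqP e; move/negP: f0; apply; apply/eqP/l2_inj => i.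
by apply/nsq_eq0/le_anti; rewrite nsq_ge0 e psum_ge_term.
Qed.

HB.instance Definition _ := isDotProduct.Build R[i] l2 l2dot l2dot_gt0.
End SquareSummable.

Lemma le_tsum_seq (R : realType) (I : choiceType) (p : I -> R) (X : set I) :
  (forall i, 0 <= p i) -> finite_set X ->
  ((\sum_(i <- fset_set X) p i)%:E <= tsum p)%E.
Proof.
move=> p0 finX; apply: esum_ge; exists X; first by split.
by rewrite fsbig_finite// sumEFin.
Qed.

Lemma tsum_le (R : realType) (I : choiceType) (p : I -> R) (c : R) :
  (forall X : set I, finite_set X -> \sum_(i <- fset_set X) p i <= c) ->
  (tsum p <= c%:E)%E.
Proof.
move=> pc; apply: ge_ereal_sup => _ [X [finX _] <-].
by rewrite fsbig_finite// sumEFin lee_fin pc.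
Qed.

Lemma sqrt_lt (R : realType) (x e : R) : 0 < e -> (Num.sqrt x < e) = (x < e ^+ 2).
Proof.
move=> e0; rewrite -[in LHS](@ger0_norm _ e) ?ltW// -sqrtr_sqr ltr_sqrt//.
by rewrite exprn_gt0.
Qed.

Section L2Complete.
Variables (R : realType) (I : choiceType) (H : hilbert R).
Notation l2 := (l2 I H).

Lemma sum_tail_small (u : nat -> l2) (l : I -> H) :
  (forall i, norm_converges (dot_norm (hdot H)) (fun n => u n i) (l i)) ->
  forall (s : seq I) (e : R), 0 < e -> exists M, forall m, (M <= m)%N ->
    \sum_(i <- s) nsq (u m i - l i) < e.
Proof.
move=> ul; elim=> [|i s IHs] e e0; first by exists 0%N => m _; rewrite big_nil.
have e2 : 0 < e / 2 by rewrite divr_gt0.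
have [M HM] := IHs _ e2.
have [M' HM'] := ul i (Num.sqrt (e / 2)) ltac:(by rewrite sqrtr_gt0).
exists (maxn M M') => m; rewrite geq_max => /andP[/HM Mm /HM' Mm'].
have : nsq (u m i - l i) < e / 2 by rewrite -ltr_sqrt.
by rewrite big_cons; lra.
Qed.

(** The limit is taken coordinatewise in H. A Fatou-type argument over finite sets of indices then
    gives convergence in norm and, through l = u N0 - (u N0 - l), square-summability. *)
Lemma l2_complete (u : nat -> l2) :
  norm_cauchy (dot_norm (@l2dot R I H)) u ->
  exists l : l2, norm_converges (dot_norm (@l2dot R I H)) u l.
Proof.
move=> cu.
have normE (f : l2) : dot_norm (@l2dot R I H) f = Num.sqrt (psum (fun i => nsq (f i))).
  by congr Num.sqrt; exact: (congr1 (@complex.Re R) (l2dotxx f)).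
have p0 (f : I -> H) i : 0 <= nsq (f i) := nsq_ge0 _.
have /choice[l ul] : forall i, exists l : H,
    norm_converges (dot_norm (hdot H)) (fun n => u n i) l.
  move=> i; apply: hcomplete => e e0; have [N HN] := cu e e0.
  exists N => m n Nm Nn; apply: le_lt_trans (HN m n Nm Nn); rewrite normE.
  by rewrite ler_wsqrtr// -l2BE psum_ge_term.
have key e : 0 < e -> exists N, forall n, (N <= n)%N ->
    (tsum (fun i => nsq (u n i - l i)) <= (e ^+ 2)%:E)%E.
  move=> e0; have [N HN] := cu (e / 2) ltac:(by rewrite divr_gt0).
  exists N => n Nn; apply: tsum_le => X finX.
  have e4 : 0 < e ^+ 2 / 4 by rewrite divr_gt0 ?exprn_gt0.
  (* The index m may depend on X, but the resulting bound 2 (e^2 / 4) + 2 (e^2 / 4) = e^2 does not,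
     hence passes to the supremum over X. *)
  have [M HM] := sum_tail_small ul (fset_set X) e4.
  have Nm := leq_maxl N M; have {HM}/ltW HM := HM _ (leq_maxr N M).
  have /ltW {}HN := HN _ _ Nn Nm.
  set m := maxn N M in HM HN Nm.
  have h : psum (fun i => nsq ((u n - u m) i)) <= e ^+ 2 / 4.
    have : psum (fun i => nsq ((u n - u m) i)) <= (e / 2) ^+ 2.
      have q0 : 0 <= psum (fun i => nsq ((u n - u m) i)).
        by apply: psum_ge0 => i; exact: nsq_ge0.
      rewrite -(sqr_sqrtr q0) -normE ler_pXn2r// nnegrE ?sqrtr_ge0//.
      by rewrite divr_ge0// ltW.
    by rewrite expr_div_n -natrX.
  apply: (@le_trans _ _ (\sum_(i <- fset_set X)
      (2 * nsq ((u n - u m) i) + 2 * nsq (u m i - l i)))).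
    apply: ler_sum => i _; apply: le_trans (nsqD_le _ _).
    by rewrite l2BE addrA subrK.
  rewrite big_split -!mulr_sumr.
  have h' : \sum_(i <- fset_set X) nsq ((u n - u m) i) <= e ^+ 2 / 4.
    apply: le_trans h; rewrite -lee_fin -psumE; [exact: le_tsum_seq|exact: p0|].
    exact/(summP (p0 (u n - u m)))/l2_summ.
  by move: h' HM => /=; lra.
have [N0 HN0] := key 1 ltr01.
pose d : I -> H := fun i => u N0 i - l i.
have s0 : d \in @sqsumm R I H.
  apply/sqsummP/(summP (p0 d)).
  by apply: le_lt_trans (HN0 _ (leqnn _)) _; rewrite ltry.
have sl : l \in @sqsumm R I H.
  have -> : l = l2v (u N0) - d by apply/funext => i /=; rewrite /d opprB addrC subrK.
  by rewrite rpredB// l2P.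
exists (L2 sl) => e e0; have [N HN] := key (e / 2) ltac:(by rewrite divr_gt0).
exists N => n /HN h; rewrite normE sqrt_lt//.
apply: (@le_lt_trans _ _ ((e / 2) ^+ 2)).
  rewrite -lee_fin -psumE//.
  exact/(summP (p0 (u n - L2 sl : l2)))/l2_summ.
by have : 0 < e ^+ 2 := exprn_gt0 2 e0; nra.
Qed.

Definition l2H : hilbert R := @Hilbert R l2 (@l2dot R I H) l2_complete.

Lemma nsq_l2 (f : l2H) : nsq f = psum (fun i => nsq ((f : l2) i)).
Proof. exact: (congr1 (@complex.Re R) (l2dotxx f)). Qed.
End L2Complete.

Section L2Maps.
Variables (R : realType) (I : choiceType) (K : hilbert R).

Lemma l2_lift (X : lmodType R[i]) (Phi : X -> I -> K) :
  (forall a x y i, Phi (a *: x + y) i = a *: Phi x i + Phi y i) ->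
  (forall x, (tsum (fun i => nsq (Phi x i)) < +oo)%E) ->
  {F : {linear X -> l2H I K} | forall x i, l2v (F x) i = Phi x i}.
Proof.
move=> lin fin.
have mem x : Phi x \in @sqsumm R I K.
  by apply/sqsummP/summP => // i; exact: nsq_ge0.
pose F x : l2H I K := L2 (mem x).
have [|G GE] := @mk_linear _ _ _ F.
  by move=> a x y; apply: l2_inj => i; exact: lin.
by exists G => x i; rewrite GE.
Qed.

Lemma l2_fin (f : l2 I K) : (tsum (fun i => nsq (f i)) < +oo)%E.
Proof. by apply/(summP (fun i => nsq_ge0 (f i)))/l2_summ. Qed.

Lemma nsq_l2E (f : l2H I K) (c : R) :
  tsum (fun i => nsq (l2v f i)) = c%:E -> nsq f = c.
Proof. by rewrite nsq_l2 /psum => ->. Qed.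

(** The maps act on all families, and the isometry condition also covers infinite sums; linearity
    and isometry of the inverse [Psi] thus follow from those of [Phi]. *)
Lemma l2_unitary (Phi Psi : (I -> K) -> I -> K) :
  (forall a f g i, Phi (fun j => a *: f j + g j) i = a *: Phi f i + Phi g i) ->
  (forall f, tsum (fun i => nsq (Phi f i)) = tsum (fun i => nsq (f i))) ->
  (forall f i, Phi (Psi f) i = f i) -> (forall f i, Psi (Phi f) i = f i) ->
  {U : operator (l2H I K) | unitary_op U &
     forall (f : l2H I K) i, l2v (U f) i = Phi (l2v f) i}.
Proof.
move=> lin iso PhiK PsiK.
have PhiK' f : Phi (Psi f) = f by apply/funext.
have PsiK' f : Psi (Phi f) = f by apply/funext.
have iso' f : tsum (fun i => nsq (Psi f i)) = tsum (fun i => nsq (f i)).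
  by rewrite -iso PhiK'.
have lin' a f g i : Psi (fun j => a *: f j + g j) i = a *: Psi f i + Psi g i.
  rewrite -{1}(PhiK' f) -{1}(PhiK' g).
  rewrite (_ : (fun j => _) = Phi (fun j => a *: Psi f j + Psi g j)) ?PsiK//.
  by apply/funext => j; rewrite lin.
have [||U UE] := @l2_lift (l2H I K) (fun f => Phi (l2v f)).
- by move=> a f g i; rewrite -lin.
- by move=> f; rewrite iso l2_fin.
have [||V VE] := @l2_lift (l2H I K) (fun f => Psi (l2v f)).
- by move=> a f g i; rewrite -lin'.
- by move=> f; rewrite iso' l2_fin.
exists U => //; apply: (@unitary_opP _ _ U V).
- move=> f; rewrite !nsq_l2 /psum -(iso (l2v f)); congr fine.
  by apply: eq_tsum => i; rewrite UE.
- move=> f; apply: l2_inj => i; rewrite VE -[RHS]PsiK.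
  by congr (Psi _ i); apply/funext => j; rewrite UE.
- move=> f; apply: l2_inj => i; rewrite UE -[RHS]PhiK.
  by congr (Phi _ i); apply/funext => j; rewrite VE.
Qed.
End L2Maps.

Lemma tsum_bij (R : realType) (I J : choiceType) (s : I -> J) (p : J -> R) :
  bijective s -> tsum (fun i => p (s i)) = tsum p.
Proof.
by move=> sb; rewrite /tsum (reindex_esum setT setT s)// setTT_bijective.
Qed.

Lemma tsum_shift (R : realType) (p : int -> R) (a : int) :
  tsum (fun n => p (n + a)) = tsum p.
Proof.
apply: (tsum_bij p (s := fun n => n + a)).
by exists (fun n => n - a) => n; rewrite ?addrK ?subrK.
Qed.

Lemma tsum_shift2 (R : realType) (p q : int -> R) (a b : int) :
  (forall n, 0 <= p n) -> (forall n, 0 <= q n) ->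
  tsum (fun n => p (n + a) + q (n + b)) = tsum (fun n => p n + q n).
Proof. by move=> p0 q0; rewrite !tsumD// !tsum_shift. Qed.

Lemma tsum_bool (R : realType) (p : bool -> R) : (forall b, 0 <= p b) ->
  tsum p = (p true + p false)%:E.
Proof.
move=> p0.
have sU : [set: bool]%classic = ([set true] `|` [set false])%classic.
  by apply/seteqP; split=> -[] //= _; [left|right].
have fb : finite_set [set: bool] by rewrite sU finite_setU.
rewrite /tsum esum_fset//; last by move=> b _; rewrite lee_fin.
rewrite sU fsbigU0/= ?fsbig_set1// => b [/= ->].
by [].
Qed.

(** Extension of a one-sided sequence by the constant z at negative indices; matching on the
    constructor of [int] lets both cases compute. *)
Definition posfun (T : Type) (z : T) (p : nat -> T) (n : int) : T :=
  if n is Posz m then p m else z.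

Lemma tsum_pos (R : realType) (p : nat -> R) :
  tsum (posfun 0 p) = tsum p.
Proof.
rewrite /tsum -(esum_image [set: nat] Posz (fun n => (posfun 0 p n)%:E)); last first.
  by move=> m n _ _ [].
rewrite [RHS]esum_mkcond; apply: eq_esum => -[n|n] _ /=.
  by rewrite mem_set//; exists n.
by rewrite memNset// => -[].
Qed.

Lemma tsum_telescope (R : realType) (a : nat -> R) :
  (forall n, a n.+1 <= a n) -> (a @ \oo --> 0)%classic ->
  tsum (fun n => a n - a n.+1) = (a 0%N)%:E.
Proof.
move=> an a0; rewrite /tsum -nneseries_esumT; last first.
  by move=> n; rewrite lee_fin subr_ge0.
apply/cvg_lim => //; apply: (@cvg_trans _ ((fun n => (a 0%N - a n)%:E) @ \oo)%classic).
  apply: near_eq_cvg; near=> n; rewrite sumEFin; congr EFin.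
  rewrite (_ : a 0%N - a n = - a n - - a 0%N); last by rewrite opprK addrC.
  rewrite -(telescope_sumr (fun k => - a k))//.
  by apply: eq_bigr => i _; rewrite opprK addrC.
apply: cvg_EFin; first by near=> n.
have : ((fun n => a 0%N - a n) @ \oo --> a 0%N - 0)%classic.
  by apply: cvgB => //; exact: cvg_cst.
by rewrite subr0.
Unshelve. all: by end_near.
Qed.

(** * The Hilbert space C^2 *)

Section Plane.
Variable R : realType.
Notation C2 := (C2 R).

Definition vec2 (a b : R[i]) : C2 := \row_(j < 2) (if j == 0 then a else b).
Definition e1 : C2 := vec2 1 0.
Definition e2 : C2 := vec2 0 1.
Definition fst2 (x : C2) : R[i] := (x : 'rV_2) 0 0.
Definition snd2 (x : C2) : R[i] := (x : 'rV_2) 0 1.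

Lemma fst_vec2 a b : fst2 (vec2 a b) = a.
Proof. by rewrite /fst2 mxE. Qed.
Lemma snd_vec2 a b : snd2 (vec2 a b) = b.
Proof. by rewrite /snd2 mxE. Qed.

Lemma eq_C2 (x y : C2) : fst2 x = fst2 y -> snd2 x = snd2 y -> x = y.
Proof.
move=> e0 e1; apply/rowP => j; case: (unliftP 0 j) => [k ->|->//].
by rewrite ord1; have -> : lift 0 0 = 1 :> 'I_2 by apply/val_inj.
Qed.

Lemma fst2D (x y : C2) : fst2 (x + y) = fst2 x + fst2 y.
Proof. by rewrite /fst2 mxE. Qed.
Lemma snd2D (x y : C2) : snd2 (x + y) = snd2 x + snd2 y.
Proof. by rewrite /snd2 mxE. Qed.
Lemma fst2Z a (x : C2) : fst2 (a *: x) = a * fst2 x.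
Proof. by rewrite /fst2 mxE. Qed.
Lemma snd2Z a (x : C2) : snd2 (a *: x) = a * snd2 x.
Proof. by rewrite /snd2 mxE. Qed.
Lemma fst2N (x : C2) : fst2 (- x) = - fst2 x.
Proof. by rewrite /fst2 mxE. Qed.
Lemma snd2N (x : C2) : snd2 (- x) = - snd2 x.
Proof. by rewrite /snd2 mxE. Qed.

Definition c2E := (fst2D, snd2D, fst2Z, snd2Z, fst2N, snd2N, fst_vec2, snd_vec2).

Lemma vec2E (x : C2) : x = fst2 x *: e1 + snd2 x *: e2.
Proof. by apply: eq_C2; rewrite !c2E; ring. Qed.

Lemma linear_vec2 (Y : lmodType R[i]) (f : {linear C2 -> Y}) (x : C2) :
  f x = fst2 x *: f e1 + snd2 x *: f e2.
Proof. by rewrite {1}(vec2E x) linearD !linearZ. Qed.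

Lemma ip_C2 (x y : C2) :
  ip x y = fst2 x * Num.conj (fst2 y) + snd2 x * Num.conj (snd2 y).
Proof.
rewrite /ip /= dotmxE mxE big_ord_recl big_ord1 !mxE.
by have -> : lift ord0 (ord0 : 'I_1) = 1 :> 'I_2 by apply/val_inj.
Qed.

Lemma nsq_C2 (x : C2) : nsq x = abs2 (fst2 x) + abs2 (snd2 x).
Proof. by rewrite /nsq ip_C2 !abs2E. Qed.

Lemma C2_adjoint (K : hilbert R) (V : {linear C2 -> K}) :
  {W : {linear K -> C2} | is_adjoint V W}.
Proof.
have [|W WE] := @mk_linear R K C2 (fun y => vec2 (ip y (V e1)) (ip y (V e2))).
  by move=> a x y; apply: eq_C2; rewrite !c2E !ipE.
exists W => x y; rewrite WE -!/(ip _ _) ip_C2 !c2E linear_vec2 !ipE.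
by rewrite (ipC (V e1) y) (ipC (V e2) y) !conjCK.
Qed.

Lemma C2_cancelC (U W : operator C2) : cancel U W -> cancel W U.
Proof.
move=> UK.
have UW1 : lin1_mx U *m lin1_mx W = 1%:M.
  by apply/row_matrixP => i; rewrite !rowE mulmxA !mul_rV_lin1 UK mulmx1.
move=> x; rewrite -(mul_rV_lin1 U) -(mul_rV_lin1 W) -mulmxA.
by rewrite (mulmx1C UW1) mulmx1.
Qed.

Lemma C2_isometry_unitary (U : operator C2) :
  (forall x, nsq (U x) = nsq x) -> unitary_op U.
Proof.
move=> UE; have [W adj] := C2_adjoint U.
suff UK : cancel U W by exists W; split=> //; exact: C2_cancelC.
move=> x; apply/eqP; rewrite -subr_eq0; apply/eqP/nsq_eq0.
have hW y z : ip (W y) z = ip y (U z).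
  by rewrite (ipC z (W y)) (ipC (U z) y); rewrite [in RHS]/ip adj.
rewrite /nsq ipDl ipNl hW.
by rewrite (ip_polar (f := U) (g := idfun) UE) subrr.
Qed.

Lemma sqrt_CC (a : R) : 0 <= a -> abs2 (Num.sqrt a)%:C%C = a.
Proof. by move=> a0; rewrite /abs2 /= expr0n addr0 sqr_sqrtr. Qed.

(* Cholesky decomposition of the positive form [<x,y> - <Tx,Ty>]; the formula
   also covers [a = 0], where [(sqrt a)^-1] is [0] and positivity forces [h = 0]. *)
Lemma C2_defect (T : operator C2) :
  (forall x, nsq (T x) <= nsq x) ->
  {D : operator C2 | forall x, nsq (D x) = nsq x - nsq (T x)}.
Proof.
move=> cT; pose a : R := 1 - nsq (T e1); pose b : R := 1 - nsq (T e2).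
pose h : R[i] := - ip (T e1) (T e2).
have qE x : nsq x - nsq (T x) = abs2 (fst2 x) * a + abs2 (snd2 x) * b
    + 2 * Re (fst2 x * Num.conj (snd2 x) * h).
  rewrite (linear_vec2 T x) nsqD !nsqZ (nsq_C2 x).
  rewrite ipZl ipZr /a /b /h !ReImE.
  move: (fst2 x) (snd2 x) (nsq (T e1)) (nsq (T e2)) (ip (T e1) (T e2)) => u v s t z.
  by rewrite /abs2; ring.
have q0 x : 0 <= nsq x - nsq (T x) by rewrite subr_ge0.
clearbody a b h.
have a0 : 0 <= a.
  by have := q0 (vec2 1 0); rewrite qE !c2E !ReImE /abs2 /=; lra.
have b0 : 0 <= b.
  by have := q0 (vec2 0 1); rewrite qE !c2E !ReImE /abs2 /=; lra.
(* The form at (- t conj(h), 1). For a = 0 and h != 0 the choice t = (b + 1) / (2 |h|^2) would give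
   the value -1; for a != 0 the choice t = 1/a gives exactly the Schur complement c = b - |h|^2 /
   a. *)
have qt (t : R) : 0 <= b + abs2 h * (t ^+ 2 * a - 2 * t).
  have := q0 (vec2 (- (t%:C%C * Num.conj h)) 1); rewrite qE !c2E /abs2 !ReImE /=.
  by congr (_ <= _); ring.
have h0 : a = 0 -> h = 0.
  move=> a00; apply: abs2_eq0; apply/eqP/negPn/negP => hn.
  have := qt ((b + 1) / (2 * abs2 h)); rewrite a00 mulr0 sub0r.
  rewrite (_ : abs2 h * _ = - (b + 1)); first lra.
  by field.
pose c := b - abs2 h / a.
have c0 : 0 <= c.
  have [/h0 hz|an] := eqVneq a 0; first by rewrite /c hz /abs2 /= expr0n addr0 mul0r subr0.
  have := qt a^-1; rewrite /c; congr (_ <= _); field => //.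
have [|D DE] := @mk_linear R C2 C2 (fun x => vec2
    ((Num.sqrt a)%:C%C * fst2 x + Num.conj h * (Num.sqrt a)^-1%:C%C * snd2 x)
    ((Num.sqrt c)%:C%C * snd2 x)).
  by move=> k x y; apply: eq_C2; rewrite !c2E; ring.
exists D => x; rewrite DE qE nsq_C2 !c2E abs2M sqrt_CC//.
have [az|an] := eqVneq a 0.
  by rewrite /c (h0 az) az sqrtr0 invr0 /abs2 !ReImE /=; ring.
have sa : Num.sqrt a != 0 by rewrite sqrtr_eq0 -ltNge lt_neqAle eq_sym an.
have saE : a = Num.sqrt a ^+ 2 by rewrite sqr_sqrtr.
rewrite /c {3 4}saE /abs2 !ReImE /=.
by field.
Qed.
End Plane.

(** * Compressions *)

(** The operators 1 - t w w^* and 1 - conj(t) w w^* are adjoint to each other, and their product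
    differs from 1 by the multiple t + conj(t) - |t|^2 |w|^2 of w w^*, which the hypothesis
    cancels. *)
Lemma reflection_unitary (R : realType) (K : hilbert R) (w : K) (t : R[i]) :
  t + Num.conj t = t * Num.conj t * (nsq w)%:C%C ->
  {G : operator K | unitary_op G & forall y, G y = y - (t * ip y w) *: w}.
Proof.
have lin (s : R[i]) a x y : a *: x + y - (s * ip (a *: x + y) w) *: w =
    a *: (x - (s * ip x w) *: w) + (y - (s * ip y w) *: w).
  rewrite !ipE scalerBr scalerA mulrDr scalerDl opprD addrACA.
  by congr (_ - _ *: w + _); ring.
have inv (s : R[i]) y : s + Num.conj s = s * Num.conj s * (nsq w)%:C%C ->
    y - (s * ip y w) *: w - (Num.conj s * ip (y - (s * ip y w) *: w) w) *: w = y.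
  move=> se; rewrite !ipE ipxx -!(scaleNr _ w) -addrA -scalerDl -[RHS]addr0.
  congr (_ + _); rewrite (_ : _ + _ =
    - ip y w * (s + Num.conj s - s * Num.conj s * (nsq w)%:C%C)); last by ring.
  by rewrite se subrr mulr0 scale0r.
move=> te; have te' : Num.conj t + Num.conj (Num.conj t) =
    Num.conj t * Num.conj (Num.conj t) * (nsq w)%:C%C.
  by rewrite conjCK addrC te [t * _]mulrC.
have [G GE] := mk_linear (lin t); have [G' G'E] := mk_linear (lin (Num.conj t)).
exists G => //; apply: (@unitary_opP _ _ G G').
- move=> y; rewrite GE nsqB nsqZ ipZr.
  have /(congr1 (@complex.Re R)) := te; move: (ip y w) (nsq w) => z m.
  rewrite !ReImE /abs2 !ReImE /= => e.
  suff -> : (Re t * Re z - Im t * Im z) ^+ 2 + (Re t * Im z + Im t * Re z) ^+ 2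
     = (Re t ^+ 2 + Im t ^+ 2) * (Re z ^+ 2 + Im z ^+ 2) by nra.
  ring.
- by move=> y; rewrite G'E GE inv.
- by move=> y; rewrite GE G'E; have := inv _ y te'; rewrite conjCK.
Qed.

(* The complex Householder reflection [1 - w w^* / <u,w>] with [w = u - v]; for [w = 0] the
   convention [0^-1 = 0] turns it into the identity. *)
Lemma unitary_move (R : realType) (K : hilbert R) (u v : K) : nsq u = nsq v ->
  {G : operator K | unitary_op G &
    G u = v /\ forall y, ip y (u - v) = 0 -> G y = y}.
Proof.
move=> uv; set w := u - v.
have we : nsq w = 2 * Re (ip u w).
  by rewrite /w nsqB ipDr ipNr ReD ReN {2}/nsq -[Re (ip u u)]/(nsq u) uv; ring.
have w0 : ip u w = 0 -> w = 0.
  by move=> uw; apply: nsq_eq0; rewrite we uw mulr0.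
have [|G Gu GE] := @reflection_unitary _ _ w (ip u w)^-1.
  have [/[dup] /w0 wz ->|n0] := eqVneq (ip u w) 0.
    by rewrite invr0 conjC0 wz nsq0 !mul0r addr0.
  have n0' : Num.conj (ip u w) != 0 by rewrite conjC_eq0.
  rewrite fmorphV.
  have -> : (nsq w)%:C%C = ip u w + Num.conj (ip u w).
    by apply: eqC; rewrite !ReImE /= ?we; ring.
  by field; rewrite ?n0 ?n0'.
exists G => //; split=> [|y y0]; rewrite GE; last by rewrite y0 mulr0 scale0r subr0.
have [/w0 wz|n0] := eqVneq (ip u w) 0.
  by rewrite wz scaler0 subr0; apply/eqP; rewrite -subr_eq0 -/w wz.
by rewrite mulVf// scale1r /w subKr.
Qed.

(** Two reflections suffice because C^2 has two basis vectors: the first sends A e1 to B e1, the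
    second sends G1 (A e2) to B e2. The second fixes B e1, since B e1 has the same inner product
    with G1 (A e2) as with B e2, by polarization. No dimension count on K is involved. *)
Lemma unitary_extension (R : realType) (K : hilbert R) (A B : {linear C2 R -> K}) :
  (forall x, nsq (A x) = nsq (B x)) ->
  {G : operator K | unitary_op G & forall x, G (A x) = B x}.
Proof.
move=> AB; have [G1 G1u [G1A _]] := unitary_move (AB (e1 R)).
have n1 : nsq (G1 (A (e2 R))) = nsq (B (e2 R)) by rewrite unitary_nsq.
have [G2 G2u [G2A G2fix]] := unitary_move n1.
have G1ip x y : ip (G1 x) (G1 y) = ip x y.
  exact: (ip_polar (f := G1) (g := idfun) (unitary_nsq G1u)).
exists (G2 \o G1); first exact: (unitary_comp G2u G1u).
move=> x; rewrite (linear_vec2 A) (linear_vec2 B) /= !linearD !linearZ /= G1A G2A.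
rewrite G2fix// ipDr ipNr -{1}G1A G1ip.
by rewrite (ip_polar AB) subrr.
Qed.

(* [rho f x] says that the vector [f] of [K] represents [x]. Contrary to the
   identity [V^* N V = T], the property [lifts] is stable under composition. *)
Definition compression (R : realType) (H K : hilbert R) (V : H -> K)
    (rho : K -> H -> Prop) : Prop :=
  [/\ forall x, rho (V x) x,
      forall a f x, rho f x -> rho (a *: f) (a *: x) &
      forall f x y, rho f x -> ip f (V y) = ip x y].

Definition lifts (R : realType) (H K : hilbert R) (rho : K -> H -> Prop)
    (N : K -> K) (T : H -> H) : Prop :=
  forall f x, rho f x -> rho (N f) (T x).

Lemma lifts_monomial (R : realType) (H K : hilbert R) (rho : K -> H -> Prop)
    (k : nat) (N : 'I_k -> operator K) (T : 'I_k -> operator H) (m : 'I_k -> nat) :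
  (forall i, lifts rho (N i) (T i)) ->
  lifts rho (op_monomial N m) (op_monomial T m).
Proof.
move=> NT; rewrite /op_monomial.
apply: (big_rec2 (fun F G => lifts rho F G)) => [f x //|i F G _ FG f x fx /=].
by elim: (m i) => [|n IHn] /=; [exact: FG|exact: NT].
Qed.

(** The last clause of [compression] says that the adjoint of V sends f to x whenever f represents
    x. It is applied to the vector N^m V x, which represents T^m x. *)
Lemma compression_dilates (R : realType) (K : hilbert R) (k : nat)
    (V : {linear C2 R -> K}) (rho : K -> C2 R -> Prop)
    (N : 'I_k -> operator K) (T : 'I_k -> operator (C2 R)) :
  compression V rho -> (forall i, lifts rho (N i) (T i)) -> dilates N T.
Proof.
move=> [Vx _ ipV] NT; have [W adj] := C2_adjoint V.
exists V, W; split=> //; first by apply: hisometryP => x; rewrite /nsq (ipV _ x).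
have hW y z : ip (W y) z = ip y (V z).
  by rewrite (ipC z (W y)) (ipC (V z) y); rewrite [in RHS]/ip adj.
move=> m x; apply/eqP; rewrite -subr_eq0; apply/eqP/nsq_eq0.
have h : rho (op_monomial N m (V x)) (op_monomial T m x) by exact: lifts_monomial.
by rewrite /nsq ipDl ipNl hW (ipV _ _ _ h) subrr.
Qed.

(** * Dilation of an anti-commuting pair *)

Lemma l2vP (R : realType) (I : choiceType) (K : hilbert R) a (f g : l2H I K) i :
  l2v (a *: f + g) i = a *: l2v f i + l2v g i.
Proof. by []. Qed.

Lemma l2vZ (R : realType) (I : choiceType) (K : hilbert R) a (f : l2H I K) i :
  l2v (a *: f) i = a *: l2v f i.
Proof. by []. Qed.

Lemma eq_l2dot (R : realType) (I : choiceType) (K : hilbert R) (f g f' g' : l2H I K) :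
  (forall i, ip (l2v f i) (l2v g i) = ip (l2v f' i) (l2v g' i)) -> ip f g = ip f' g'.
Proof. by move=> h; apply: eqC; apply: eq_rsum => i; rewrite h. Qed.

Section Pair2.
Variables (R : realType) (H : hilbert R).

Lemma bool_sqsumm (f : bool -> H) : f \in @sqsumm R bool H.
Proof.
have f0 b : 0 <= nsq (f b) by exact: nsq_ge0.
by apply/sqsummP/(summP f0); rewrite tsum_bool// ltry.
Qed.

(** The direct sum H + H is encoded as l^2 over [bool], which makes completeness and [l2_unitary]
    available for it. *)
Definition bfun (f : bool -> H) : l2H bool H := L2 (bool_sqsumm f).
Definition pair2 (x y : H) := bfun (fun b => if b then x else y).

Lemma nsq_bool (e : l2H bool H) : nsq e = nsq (l2v e true) + nsq (l2v e false).
Proof. by apply: nsq_l2E; rewrite tsum_bool// => b; exact: nsq_ge0. Qed.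

Lemma eq_bool (e e' : l2H bool H) :
  l2v e true = l2v e' true -> l2v e false = l2v e' false -> e = e'.
Proof. by move=> h h'; apply: l2_inj => -[]. Qed.
End Pair2.

Section Alternating.
Variable R : realType.
Definition alt (n : int) : R[i] := (-1) ^ n.

Lemma alt_sqr n : alt n * alt n = 1.
Proof. by rewrite /alt -expfzMl mulrNN mulr1 exp1rz. Qed.

Lemma altS n : alt (n + 1) = - alt n.
Proof. by rewrite /alt expfzDr ?oppr_eq0 ?oner_eq0// expr1z mulrN1. Qed.

Lemma altB n : alt (n - 1) = - alt n.
Proof. by rewrite -[in RHS](subrK 1 n) altS opprK. Qed.

Lemma abs2_alt n : abs2 (alt n) = 1.
Proof.
have h : abs2 (alt n) * abs2 (alt n) = 1.
  by rewrite -abs2M alt_sqr /abs2 /=; ring.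
have := abs2_ge0 (alt n); nra.
Qed.
End Alternating.

Lemma abs2_real (R : realType) (a : R) : abs2 a%:C%C = a ^+ 2.
Proof. by rewrite /abs2 /=; ring. Qed.

Section PairDilation.
Variables (R : realType).
Notation C2 := (C2 R).

(** The relation [rho] is part of the data: a bare dilation could not be composed with the later
    dilations of scalars and phases. *)
Definition pair_dilation (T1 T2 : operator C2) : Prop :=
  exists (K : hilbert R) (V : {linear C2 -> K}) (rho : K -> C2 -> Prop)
         (W1 W2 : operator K),
    [/\ compression V rho, lifts rho W1 T1, lifts rho W2 T2,
        unitary_op W1 /\ unitary_op W2 & forall f, W1 (W2 f) = - W2 (W1 f)].

(* With [E] = C^2 + C^2 and [G] a unitary of [E] extending the isometry
   (D1 T2 x, D2 x) |-> (D1 x, D2 T1 x), where [|Di x|^2 = |x|^2 - |Ti x|^2],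
   the unitaries are the Berger-Coburn-Lebow pair on l^2(Z; E), up to the signs (-1)^n. *)
Lemma pure_pair_dilation (T1 T2 : operator C2) :
  (forall x, nsq (T1 x) <= nsq x) -> (forall x, nsq (T2 x) <= nsq x) ->
  (forall x, T1 (T2 x) = - T2 (T1 x)) ->
  (forall x, ((fun m => nsq (iter m (T1 \o T2) x)) @ \oo --> (0 : R))%classic) ->
  pair_dilation T1 T2.
Proof.
move=> c1 c2 T12 pure.
have [D1 D1E] := C2_defect c1; have [D2 D2E] := C2_defect c2.
pose E := l2H bool C2.
have [|A AE] := @mk_linear R C2 E (fun x => pair2 (D1 (T2 x)) (D2 x)).
  by move=> a x y; apply: eq_bool; rewrite /= !linearP.
have [|B BE] := @mk_linear R C2 E (fun x => pair2 (D1 x) (D2 (T1 x))).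
  by move=> a x y; apply: eq_bool; rewrite /= !linearP.
have nA x : nsq (A x) = nsq x - nsq (T1 (T2 x)).
  by rewrite AE nsq_bool /= D1E D2E addrC addrA subrK.
have nB x : nsq (B x) = nsq x - nsq (T2 (T1 x)).
  by rewrite BE nsq_bool /= D1E D2E addrA subrK.
(* The defects telescope to |A x|^2 = |x|^2 - |T1 T2 x|^2 and |B x|^2 = |x|^2 - |T2 T1 x|^2, which
   agree because T1 T2 and T2 T1 differ by a sign only. *)
have [|G Gu GA] := @unitary_extension R E A B.
  by move=> x; rewrite nA nB T12 nsqN.
have [G' [GK G'K G'u G'E]] := unitary_inv Gu.
have GE := unitary_nsq Gu.
pose T := T1 \o T2.
pose Vf x (n : int) : E := posfun 0 (fun m => A (iter m T x)) n.
have Tlin m a x y : iter m T (a *: x + y) = a *: iter m T x + iter m T y.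
  by elim: m => //= m ->; rewrite /T /= !linearP.
(* The terms are |T^m x|^2 - |T^(m+1) x|^2, and purity makes the limit of |T^m x|^2 vanish. *)
have Vn x : tsum (fun n => nsq (Vf x n)) = (nsq x)%:E.
  rewrite (@eq_tsum _ _ _ (posfun 0 (fun m => nsq (A (iter m T x))))).
    have := @tsum_telescope _ (fun m => nsq (iter m T x)) _ (pure x) => <-; last first.
      by move=> m /=; apply: le_trans (c1 _) (c2 _).
    by rewrite tsum_pos; apply: eq_tsum => m; rewrite nA.
  by case=> m //=; rewrite nsq0.
have [||V VE] := @l2_lift R int E C2 Vf.
- move=> a x y [m|m] /=; first by rewrite Tlin linearP.
  by rewrite scaler0 addr0.
- by move=> x; rewrite Vn ltry.
have nV x : nsq (V x) = nsq x.
  by apply: nsq_l2E; rewrite -Vn; apply: eq_tsum => n; rewrite VE.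
have Gn (f : int -> E) : tsum (fun n => nsq (G (f n))) = tsum (fun n => nsq (f n)).
  by apply: eq_tsum => n; rewrite GE.
have splitE (f : int -> E) (a b : int) :
    tsum (fun n => nsq (l2v (f (n + a)) true) + nsq (l2v (f (n + b)) false)) =
    tsum (fun n => nsq (f n)).
  pose p n := nsq (l2v (f n) true); pose q n := nsq (l2v (f n) false).
  rewrite (@eq_tsum _ _ _ (fun n => p (n + a) + q (n + b)))//.
  rewrite tsum_shift2; try by move=> n; exact: nsq_ge0.
  by apply: eq_tsum => n; rewrite nsq_bool.
have nalt n (e : E) : nsq (alt R n *: e) = nsq e by rewrite nsqZ abs2_alt mul1r.
have altK n (e : E) : alt R n *: (alt R n *: e) = e.
  by rewrite scalerA alt_sqr scale1r.
(* With S f n = f (n + 1) and P, P' the projections onto the two summands of E, the unsigned maps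
   are (P S + P') G and G^-1 (P + P' S); their product is S in either order. The factors [alt] and
   the minus sign in [F1] turn the two products into S and - S. *)
pose F1 (f : int -> E) n : E :=
  alt R n *: pair2 (- l2v (G (f (n + 1))) true) (l2v (G (f n)) false).
pose F1' (f : int -> E) n : E :=
  alt R n *: G' (pair2 (l2v (f (n - 1)) true) (l2v (f n) false)).
pose F2 (f : int -> E) n : E :=
  alt R n *: G' (pair2 (l2v (f n) true) (l2v (f (n + 1)) false)).
pose F2' (f : int -> E) n : E :=
  alt R n *: pair2 (l2v (G (f n)) true) (- l2v (G (f (n - 1))) false).
have [||||W1 W1u W1E] := @l2_unitary R int E F1 F1'.
- move=> a f g n; rewrite /F1 !linearP scalerA mulrC -scalerA -scalerDr.
  by congr (_ *: _); apply: eq_bool; rewrite !l2vP /= ?l2vP.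
- move=> f; apply: etrans (Gn f); apply: etrans (splitE (fun n => G (f n)) 1 0).
  by apply: eq_tsum => n; rewrite nalt nsq_bool /= nsqN addr0.
- move=> f n; rewrite /F1 /F1' !linearZ /= !G'K /= addrK altS.
  rewrite -[RHS](altK n); congr (_ *: _).
  by apply: eq_bool; rewrite !l2vZ /= ?l2vZ /= ?scaleNr ?scalerN ?opprK.
- move=> f n; rewrite /F1 /F1' /= subrK altB.
  rewrite -[RHS](altK n); congr (_ *: _); rewrite -[RHS]GK linearZ /=; congr (G' _).
  by apply: eq_bool => //=; rewrite -[RHS]opprK -scalerN -scaleNr.
have [||||W2 W2u W2E] := @l2_unitary R int E F2 F2'.
- move=> a g h n; rewrite /F2.
  rewrite scalerA mulrC -scalerA -scalerDr; congr (_ *: _); rewrite -linearP.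
  by congr (G' _); apply: eq_bool.
- move=> f; apply: etrans (splitE f 0 1).
  by apply: eq_tsum => n; rewrite nalt G'E nsq_bool /= addr0.
- move=> f n; rewrite /F2 /F2' /= addrK altS.
  rewrite -[RHS](altK n); congr (_ *: _); rewrite -[RHS]GK linearZ /=; congr (G' _).
  by apply: eq_bool => //=; rewrite -[RHS]opprK -scalerN -scaleNr.
- move=> f n; rewrite /F2 /F2' !linearZ /= !G'K /= subrK altB.
  rewrite -[RHS](altK n); congr (_ *: _).
  by apply: eq_bool; rewrite !l2vZ /= ?l2vZ /= ?scaleNr ?scalerN ?opprK.
(* Only nonnegative indices are constrained: [F1] and [F2] read f at n and n + 1, so the constraint
   propagates, and V y vanishes at negative indices, so inner products with V y ignore f there. *)
pose rho (f : l2H int E) (x : C2) := forall m : nat, l2v f m = A (iter m T x).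
have T1T m x : iter m T (T1 x) = (-1) ^+ m *: T1 (iter m T x).
  elim: m => [|m IHm]; first by rewrite expr0 scale1r.
  rewrite /= IHm /T /= !linearZ /= -[T2 (T1 _)]opprK -T12 linearN exprS mulN1r scaleNr.
  by rewrite -scalerN.
have T2T m x : iter m T (T2 x) = (-1) ^+ m *: T2 (iter m T x).
  elim: m => [|m IHm]; first by rewrite expr0 scale1r.
  by rewrite /= IHm /T /= !linearZ /= T12 exprS mulN1r scaleNr scalerN.
exists (l2H int E), V, rho, W1, W2; split=> //.
- split.
  + by move=> x m; rewrite VE.
  + have iterZ m a x : iter m T (a *: x) = a *: iter m T x.
      by elim: m => //= m ->; rewrite /T /= !linearZ.
    by move=> a f x fx m; rewrite l2vZ fx iterZ linearZ.
  + move=> f x y fx; apply: etrans (ip_polar (f := V) (g := idfun) nV x y).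
    apply: (@eq_l2dot _ _ _ f (V y) (V x) (V y)).
    case=> m.
      by rewrite (fx m) (VE x).
    by rewrite (VE y) !ip0r.
- move=> f x fx m; rewrite W1E /F1 T1T linearZ AE; congr (_ *: _).
  rewrite -PoszD addn1 !fx !GA !BE /=; apply: eq_bool => //=.
  by rewrite -[T2 (T1 _)]opprK -T12 linearN.
- move=> f x fx m; rewrite W2E /F2 T2T linearZ; congr (_ *: _).
  rewrite -PoszD addn1 !fx -[RHS]GK GA; congr (G' _).
  by rewrite !AE BE; apply: eq_bool.
move=> f; apply: l2_inj => n; rewrite W1E /F1 !W2E /F2 !linearZ /= !G'K.
transitivity (l2v f (n + 1)).
  rewrite -[RHS](altK n); congr (_ *: _); apply: eq_bool => //=.
  by rewrite altS scaleNr scalerN opprK.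
transitivity (- F2 (l2v (W1 f)) n); last by rewrite -W2E.
rewrite /F2 !W1E -scalerN -[LHS](altK n); congr (_ *: _); rewrite -linearN /=.
rewrite -[LHS]GK; congr (G' _); rewrite linearZ /F1 altS /=.
apply: eq_bool => /=; rewrite -[LHS]opprK; [by rewrite -scalerN|by rewrite -scaleNr].
Qed.
End PairDilation.

(** * Anti-commuting operators on C^2 *)

Section TraceAlgebra.
Variable R : realType.
Notation C2 := (C2 R).
Notation e1 := (e1 R).
Notation e2 := (e2 R).
Implicit Types S T P Q N X : operator C2.

Definition tr2 (T : C2 -> C2) : R[i] := fst2 (T e1) + snd2 (T e2).

Definition anti (S T : C2 -> C2) : Prop := forall x, S (T x) = - T (S x).

Lemma fst2_lin T x : fst2 (T x) = fst2 x * fst2 (T e1) + snd2 x * fst2 (T e2).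
Proof. by rewrite (linear_vec2 T x) !c2E. Qed.
Lemma snd2_lin T x : snd2 (T x) = fst2 x * snd2 (T e1) + snd2 x * snd2 (T e2).
Proof. by rewrite (linear_vec2 T x) !c2E. Qed.

Lemma fst_e1 : fst2 e1 = 1. Proof. exact: fst_vec2. Qed.
Lemma snd_e1 : snd2 e1 = 0. Proof. exact: snd_vec2. Qed.

Lemma addrr_eq0 (z : R[i]) : z + z = 0 -> z = 0.
Proof. by move=> /eqP; rewrite -mulr2n mulrn_eq0 /= => /eqP. Qed.

(** The four entries of the matrix S T + T S; the off-diagonal ones factor through the traces of S
    and T. *)
Lemma antiE S T : anti S T ->
  [/\ fst2 (S e1) * fst2 (T e1) *+ 2 + fst2 (S e2) * snd2 (T e1)
        + fst2 (T e2) * snd2 (S e1) = 0,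
      snd2 (S e1) * tr2 T + snd2 (T e1) * tr2 S = 0,
      fst2 (S e2) * tr2 T + fst2 (T e2) * tr2 S = 0 &
      snd2 (S e2) * snd2 (T e2) *+ 2 + fst2 (S e2) * snd2 (T e1)
        + fst2 (T e2) * snd2 (S e1) = 0].
Proof.
move=> ST; have h x : S (T x) + T (S x) = 0 by rewrite ST addNr.
have f0 : fst2 (0 : C2) = 0 by rewrite /fst2 mxE.
have s0 : snd2 (0 : C2) = 0 by rewrite /snd2 mxE.
have /(congr1 (@fst2 R)) := h e1; have /(congr1 (@snd2 R)) := h e1.
have /(congr1 (@fst2 R)) := h e2; have /(congr1 (@snd2 R)) := h e2.
rewrite f0 s0 !c2E !(fst2_lin S (T _)) !(snd2_lin S (T _)).
rewrite !(fst2_lin T (S _)) !(snd2_lin T (S _)) /tr2.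
move: (fst2 (S _)) (snd2 (S _)) (fst2 (S _)) (snd2 (S _)) => a b c d.
move: (fst2 (T _)) (snd2 (T _)) (fst2 (T _)) (snd2 (T _)) => a' b' c' d'.
move=> h1 h2 h3 h4; split.
- by rewrite -[RHS]h4; ring.
- by rewrite -[RHS]h3; ring.
- by rewrite -[RHS]h2; ring.
- by rewrite -[RHS]h1; ring.
Qed.

Lemma tr2_anti S T : anti S T -> tr2 (S \o T) = 0.
Proof.
move=> /antiE[h1 _ _ h4]; apply: addrr_eq0.
rewrite /tr2 /= (fst2_lin S (T e1)) (snd2_lin S (T e2)).
by rewrite -[RHS](addr0 0) -[X in _ = X + _]h1 -[X in _ = _ + X]h4; ring.
Qed.

Lemma op_eq (T : operator C2) (U : C2 -> C2) :
  (forall a x y, U (a *: x + y) = a *: U x + U y) ->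
  T e1 = U e1 -> T e2 = U e2 -> forall x, T x = U x.
Proof.
move=> Ul h1 h2; have [V VE] := mk_linear Ul => x.
by rewrite -VE (linear_vec2 T) (linear_vec2 V) !VE h1 h2.
Qed.

Lemma traceless_snd T : tr2 T = 0 -> snd2 (T e2) = - fst2 (T e1).
Proof. by rewrite /tr2 addrC => /eqP; rewrite addr_eq0 => /eqP. Qed.

(** Cayley-Hamilton: the scalar is - det T. *)
Lemma traceless_sqr T : tr2 T = 0 -> {s : R[i] | forall x, T (T x) = s *: x}.
Proof.
move=> t0; have dE := traceless_snd t0.
exists (fst2 (T e1) ^+ 2 + snd2 (T e1) * fst2 (T e2)) => x.
apply: eq_C2; rewrite !c2E (fst2_lin T (T x), snd2_lin T (T x)).
all: by rewrite (fst2_lin T x) (snd2_lin T x) dE; ring.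
Qed.

(** By polarized Cayley-Hamilton, P Q + Q P is scalar for traceless P and Q. In coordinates, the
    entries of the commutator are, up to sign and a factor 2, the minors [z1], [z2], [z3] of the two
    coefficient triples. *)
Lemma traceless_comm P Q : tr2 P = 0 -> tr2 Q = 0 ->
  (forall x, P (Q x) = Q (P x)) -> {s : R[i] | forall x, P (Q x) = s *: x}.
Proof.
move=> t0 t0' PQ.
have dE := traceless_snd t0.
have dE' := traceless_snd t0'.
exists (fst2 (P e1) * fst2 (Q e1) + fst2 (P e2) * snd2 (Q e1)) => x.
have /(congr1 (@fst2 R)) := PQ e1; have /(congr1 (@snd2 R)) := PQ e1.
have /(congr1 (@fst2 R)) := PQ e2.
rewrite !(fst2_lin P (Q _)) !(snd2_lin P (Q _)).
rewrite !(fst2_lin Q (P _)) !(snd2_lin Q (P _)) dE dE'.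
have fE := (fst2_lin P (Q x), fst2_lin Q x, snd2_lin P (Q x), snd2_lin Q x, dE, dE').
move=> h1 h2 h3; apply: eq_C2; rewrite !c2E !fE; move: h1 h2 h3.
all: move: (fst2 (P e1)) (snd2 (P e1)) (fst2 (P e2)) => a b c.
all: move: (fst2 (Q e1)) (snd2 (Q e1)) (fst2 (Q e2)) => a' b' c' h1 h2 h3.
all: have z1 : c' * a - a' * c = 0 by apply: addrr_eq0; move: h1 => /eqP;
  rewrite -subr_eq0 => /eqP h1; rewrite -[RHS]h1; ring.
all: have z2 : a' * b - b' * a = 0 by apply: addrr_eq0; move: h2 => /eqP;
  rewrite -subr_eq0 => /eqP h2; rewrite -[RHS]h2; ring.
all: have z3 : b' * c - b * c' = 0 by move: h3 => /eqP;
  rewrite -subr_eq0 => /eqP h3; rewrite -[RHS]h3; ring.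
  rewrite -[RHS]addr0 -[X in _ = _ + X](mulr0 (snd2 x)) -[X in _ = _ + _ * X]z1; ring.
rewrite -[RHS]addr0 -[X in _ = _ + X](mulr0 (fst2 x)) -[X in _ = _ + _ * X]z2.
rewrite -[RHS]subr0 -[X in _ = _ - X](mulr0 (snd2 x)) -[X in _ = _ - _ * X]z3; ring.
Qed.

Lemma op_neq0 T : nonzero_op T -> tr2 T = 0 -> fst2 (T e2) = 0 -> snd2 (T e1) = 0 ->
  fst2 (T e1) != 0.
Proof.
move=> [x Tx] t0 c0 b0; apply/eqP => a0.
have d0 : snd2 (T e2) = 0 by move: t0; rewrite /tr2 a0 add0r.
move/eqP: Tx; apply; apply: eq_C2; rewrite (fst2_lin T x, snd2_lin T x) ?a0 ?b0 ?c0 ?d0.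
all: by rewrite !mulr0 addr0 ?/fst2 ?/snd2 mxE.
Qed.

(** If tr S != 0, then tr T and tr Q are nonzero too ([key]). The off-diagonal entries then satisfy
    x_i t_j + x_j t_i = 0 for three indices with all t_i nonzero, hence vanish. Three nonzero
    diagonal matrices would remain with pairwise zero products, which two diagonal positions do not
    allow. *)
Lemma three_anti_traceless S T Q : nonzero_op T -> nonzero_op Q ->
  anti S T -> anti S Q -> anti T Q -> tr2 S = 0.
Proof.
move=> nT nQ ST SQ TQ; apply/eqP/negPn/negP => s0.
have key X : nonzero_op X -> anti S X -> tr2 X != 0.
  move=> nX /antiE[h1 h2 h3 h4]; apply/eqP => x0.
  have /eqP := h2; rewrite x0 mulr0 add0r mulf_eq0 (negbTE s0) orbF => /eqP b0.
  have /eqP := h3; rewrite x0 mulr0 add0r mulf_eq0 (negbTE s0) orbF => /eqP c0.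
  have a0 := op_neq0 nX x0 c0 b0.
  have dE := traceless_snd x0.
  move: h1 h4; rewrite b0 c0 !mul0r !mulr0 !addr0 dE => /eqP + /eqP.
  rewrite !mulrn_eq0 /= !mulf_eq0 oppr_eq0 (negbTE a0) !orbF => /eqP sa /eqP sd.
  by move: s0; rewrite /tr2 sa sd addr0 eqxx.
have t0 := key _ nT ST; have q0 := key _ nQ SQ.
have [h1 h2 h3 h4] := antiE ST; have [k1 k2 k3 k4] := antiE SQ.
have [l1 l2 l3 l4] := antiE TQ.
have pair0 (x y z sx sy sz : R[i]) : sx != 0 -> sy != 0 -> sz != 0 ->
    x * sy + y * sx = 0 -> x * sz + z * sx = 0 -> y * sz + z * sy = 0 -> x = 0.
  move=> sx0 sy0 sz0 e e' e''; apply/eqP.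
  suff : (x * (sy * sz)) + (x * (sy * sz)) == 0.
    by rewrite -mulr2n mulrn_eq0 /= !mulf_eq0 (negbTE sy0) (negbTE sz0) !orbF.
  apply/eqP; rewrite (_ : _ + _ = (x * sy + y * sx) * sz + (x * sz + z * sx) * sy
    - (y * sz + z * sy) * sx); last by ring.
  by rewrite e e' e'' !mul0r subr0 addr0.
have b0 := pair0 _ _ _ _ _ _ s0 t0 q0 h2 k2 l2.
have c0 := pair0 _ _ _ _ _ _ s0 t0 q0 h3 k3 l3.
have b0' : snd2 (T e1) = 0.
  by move: h2 => /eqP; rewrite b0 mul0r add0r mulf_eq0 (negbTE s0) orbF => /eqP.
have c0' : fst2 (T e2) = 0.
  by move: h3 => /eqP; rewrite c0 mul0r add0r mulf_eq0 (negbTE s0) orbF => /eqP.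
have b0'' : snd2 (Q e1) = 0.
  by move: k2 => /eqP; rewrite b0 mul0r add0r mulf_eq0 (negbTE s0) orbF => /eqP.
move: h1 h4 k1 k4 l1 l4; rewrite b0 c0 b0' c0' b0'' !mul0r !mulr0 !addr0.
move=> /eqP + /eqP + /eqP + /eqP + /eqP + /eqP.
rewrite !mulrn_eq0 /= !mulf_eq0; move: s0 t0 q0; rewrite /tr2.
have [->|/=] := eqVneq (fst2 (S e1)) 0; rewrite ?add0r.
  move=> s0 t0 q0 _; rewrite (negbTE s0) /= => /eqP d0 _ /eqP d0'.
  by move: t0 q0; rewrite d0 d0' !addr0 => /negbTE -> /negbTE ->.
move=> a0 s0 t0 q0 /eqP d0 + /eqP d0'; move: t0 q0; rewrite d0 d0' !add0r.
by move=> t0 q0 _ _ _; rewrite (negbTE t0) (negbTE q0).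
Qed.

(** On the 3-dimensional space of traceless matrices, - det is a nondegenerate quadratic form, so
    its isotropic subspaces have dimension at most 1; the hypotheses make the span of X and N
    isotropic. Concretely, the square of each 2 x 2 minor of the coefficients lies in the ideal of
    the three equations. *)
Lemma nilpotent_parallel X N : nonzero_op N -> tr2 X = 0 -> tr2 N = 0 ->
  (forall x, X (X x) = 0) -> (forall x, N (N x) = 0) -> anti X N ->
  {d : R[i] | forall x, X x = d *: N x}.
Proof.
move=> nN x0 n0 XX NN XN; have [h1 _ _ _] := antiE XN.
have dX := traceless_snd x0.
have dN := traceless_snd n0.
have f0 : fst2 (0 : C2) = 0 by rewrite /fst2 mxE.
have /(congr1 (@fst2 R)) := XX e1; have /(congr1 (@fst2 R)) := NN e1.
rewrite f0 (fst2_lin X (X e1)) (fst2_lin N (N e1)) => qN qX.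
have nE := op_neq0 nN n0.
suff [d [da db dc]] : {d : R[i] | [/\ fst2 (X e1) = d * fst2 (N e1),
    snd2 (X e1) = d * snd2 (N e1) & fst2 (X e2) = d * fst2 (N e2)]}.
  exists d; apply: op_eq => [a u v||].
  - by rewrite linearP scalerDr !scalerA mulrC.
  - by apply: eq_C2; rewrite !c2E.
  - by apply: eq_C2; rewrite !c2E ?dX ?dN ?da ?mulrN.
move: nE h1 qN qX.
move: (fst2 (X e1)) (snd2 (X e1)) (fst2 (X e2)) => x z y.
move: (fst2 (N e1)) (snd2 (N e1)) (fst2 (N e2)) => p r q nE h1 qN qX.
have sqr0 (w : R[i]) : w ^+ 2 = 0 -> w = 0 by move/eqP; rewrite sqrf_eq0 => /eqP.
have c1 : p * y = q * x.
  apply/subr0_eq/sqr0; rewrite (_ : _ ^+ 2 = (p * p + r * q) * y ^+ 2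
    + (x * x + z * y) * q ^+ 2 - q * y * (x * p *+ 2 + y * r + q * z)); last ring.
  by rewrite qN qX h1 !mul0r mulr0 subr0 addr0.
have c2 : p * z = r * x.
  apply/subr0_eq/sqr0; rewrite (_ : _ ^+ 2 = (p * p + r * q) * z ^+ 2
    + (x * x + z * y) * r ^+ 2 - r * z * (x * p *+ 2 + y * r + q * z)); last ring.
  by rewrite qN qX h1 !mul0r mulr0 subr0 addr0.
have c3 : q * z = r * y.
  apply/subr0_eq/sqr0.
  rewrite (_ : _ ^+ 2 = (x * p *+ 2 + y * r + q * z) * (q * z + r * y - x * p *+ 2)
    - (p * p + r * q) * (z * y *+ 4) + (x * x + z * y) * (p * p *+ 4)); last ring.
  by rewrite qN qX h1 !mul0r subr0 addr0.
have [q0|q0] := eqVneq q 0; last first.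
  exists (y / q); split.
  - by apply: (mulfI q0); rewrite -c1; field.
  - by apply: (mulfI q0); rewrite c3; field.
  - by rewrite mulfVK.
have [r0|r0] := eqVneq r 0; last first.
  exists (z / r); split.
  - by apply: (mulfI r0); rewrite -c2; field.
  - by rewrite mulfVK.
  - by apply: (mulfI r0); rewrite -c3; field.
have p0 := nE q0 r0.
exists (x / p); split.
- by rewrite mulfVK.
- by apply: (mulfI p0); rewrite c2; field.
- by apply: (mulfI p0); rewrite c1; field.
Qed.
End TraceAlgebra.

Lemma opnorm_ge (R : realType) (H K : hilbert R) (T : H -> K) (x : H) :
  hnorm x <= 1 -> ((hnorm (T x))%:E <= opnorm T)%E.
Proof. by move=> x1; apply: ereal_sup_ubound; exists x. Qed.

Lemma contraction_nsq (R : realType) (H : hilbert R) (T : operator H) :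
  contraction_op T -> forall x, nsq (T x) <= nsq x.
Proof.
move=> cT x; have [x0|x0] := eqVneq (nsq x) 0.
  by rewrite (nsq_eq0 x0) linear0.
have xp : 0 < nsq x by rewrite lt_neqAle eq_sym x0 nsq_ge0.
pose s : R[i] := (Num.sqrt (nsq x))^-1%:C%C.
have sE : abs2 s = (nsq x)^-1.
  by rewrite abs2_real exprVn sqr_sqrtr ?ltW.
have : hnorm (T (s *: x)) <= 1.
  rewrite -lee_fin; apply: le_trans cT; apply: opnorm_ge.
  by rewrite hnormE nsqZ sE mulVf// sqrtr1.
rewrite linearZ hnormE nsqZ sE => h.
have : Num.sqrt ((nsq x)^-1 * nsq (T x)) ^+ 2 <= 1 by rewrite expr_le1 ?sqrtr_ge0.
by rewrite sqr_sqrtr ?mulr_ge0 ?invr_ge0 ?nsq_ge0// ler_pdivrMl// mulr1.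
Qed.

(** Monotonicity gives a limit l, and the recurrence gives l = r l; r != 1 is enough to conclude,
    without any geometric estimate. *)
Lemma iter_sqr_cvg0 (R : realType) (a : nat -> R) (r : R) :
  (forall n, 0 <= a n) -> (forall n, a n.+1 <= a n) ->
  (forall n, a n.+2 = r * a n) -> r != 1 -> (a @ \oo --> (0 : R))%classic.
Proof.
move=> a0 an ar r1.
have ni : nonincreasing_seq a by apply/nonincreasing_seqP.
have cva : cvgn a.
  by apply: nonincreasing_is_cvgn => //; exists 0 => _ [n _ <-].
have h : ((fun n => a n.+2) @ \oo --> limn a)%classic.
  have -> : (fun n => a n.+2) = [sequence a (n + 2)%N]_n.
    by apply/funext => n /=; rewrite addn2.
  by rewrite cvg_shiftn.
have h' : ((fun n => a n.+2) @ \oo --> r * limn a)%classic.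
  by under eq_fun do rewrite ar; apply: cvgMr.
have e : limn a = r * limn a by apply: cvg_unique h h'.
have l0 : limn a = 0.
  have /eqP : (1 - r) * limn a = 0 by rewrite mulrBl mul1r -e subrr.
  by rewrite mulf_eq0 subr_eq0 eq_sym (negbTE r1) => /eqP.
by rewrite -l0.
Qed.

Lemma rsum_bool (R : realType) (a : bool -> R) : rsum a = a true + a false.
Proof.
rewrite /rsum /psum !tsum_bool /=; try by move=> b; rewrite le_max lexx orbT.
by case: (lerP (a true) 0); case: (lerP (a false) 0); case: (lerP (- a true) 0);
  case: (lerP (- a false) 0); lra.
Qed.

Lemma ip_bool (R : realType) (H : hilbert R) (f g : l2H bool H) :
  ip f g = ip (l2v f true) (l2v g true) + ip (l2v f false) (l2v g false).
Proof. by apply: eqC; rewrite !ReImE; exact: rsum_bool. Qed.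

(** * Dilations of pairs, scalars and phases *)

Section Dilations.
Variable R : realType.
Notation C2 := (C2 R).

Lemma anti_pair_dilation (T1 T2 : operator C2) :
  (forall x, nsq (T1 x) <= nsq x) -> (forall x, nsq (T2 x) <= nsq x) ->
  anti T1 T2 -> pair_dilation T1 T2.
Proof.
move=> c1 c2 T12.
have [d dE] := @traceless_sqr R (T1 \o T2) (tr2_anti T12).
have [d1|d1] := eqVneq (abs2 d) 1; last first.
  apply: pure_pair_dilation => // x.
  apply: (@iter_sqr_cvg0 R (fun n => nsq (iter n (T1 \o T2) x)) (abs2 d)) => [n|n|n|//].
  - exact: nsq_ge0.
  - by apply: le_trans (c1 _) (c2 _).
  - by have /= := dE (iter n (T1 \o T2) x) => /= ->; rewrite nsqZ.
(* Here |x| = |(T1 T2)^2 x|, and anti-commutation makes T1 the factor applied first to x; the three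
   other contractions then give |x| <= |T1 x|. *)
have n1 x : nsq (T1 x) = nsq x.
  apply: le_anti; apply/andP; split; first exact: c1.
  rewrite -[nsq x]mul1r -d1 -nsqZ -dE /= (T12 x) !linearN /= nsqN.
  by apply: le_trans (c1 _) _; apply: le_trans (c2 _) _; apply: c2.
have n2 x : nsq (T2 x) = nsq x.
  apply: le_anti; apply/andP; split; first exact: c2.
  rewrite -[nsq x]mul1r -d1 -nsqZ -dE /=.
  by apply: le_trans (c1 _) _; apply: le_trans (c2 _) _; apply: c1.
exists C2, idfun, (fun f x => f = x), T1, T2; split.
- split; first by move=> x.
  + by move=> a f x ->.
  + by move=> f x y ->.
- by move=> f x ->.
- by move=> f x ->.
- by split; exact: C2_isometry_unitary.
- exact: T12.
Qed.

(* The scalar [c] is the compression of the bilateral shift to the unit vector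
   proportional to the geometric sequence of ratio [c]. *)
Lemma scalar_dilation (H K : hilbert R) (V : {linear H -> K}) rho (c : R[i]) :
  compression V rho -> abs2 c < 1 ->
  exists (V' : {linear H -> l2H int K}) (rho' : l2H int K -> H -> Prop),
    compression V' rho' /\
    forall (W : operator K) (a : nat), unitary_op W ->
      exists U : operator (l2H int K),
        [/\ unitary_op U, forall f n, l2v (U f) n = W (l2v f (n + a)) &
          forall T : operator H, lifts rho W T ->
            lifts rho' U (fun x => c ^+ a *: T x)].
Proof.
move=> [Vx Va Vip] c1; pose s : R[i] := (Num.sqrt (1 - abs2 c))%:C%C.
have sE : abs2 s = 1 - abs2 c by rewrite abs2_real sqr_sqrtr ?subr_ge0 ?ltW.
pose F (z : K) n := posfun 0 (fun m => (s * c ^+ m) *: z) n.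
have nF z : tsum (fun n => nsq (F z n)) = (nsq z)%:E.
  rewrite (@eq_tsum _ _ _ (posfun 0 (fun m => nsq ((s * c ^+ m) *: z)))); last first.
    by case=> m //=; rewrite nsq0.
  rewrite tsum_pos.
  have cz : ((fun m => abs2 c ^+ m * nsq z) @ \oo --> (0 : R))%classic.
    rewrite -[X in (_ --> X)%classic](mul0r (nsq z)); apply: cvgMl.
    by apply: cvg_expr; rewrite ger0_norm ?abs2_ge0.
  have h m : abs2 c ^+ m.+1 * nsq z <= abs2 c ^+ m * nsq z.
    rewrite ler_wpM2r ?nsq_ge0// exprS ler_piMl ?exprn_ge0 ?abs2_ge0//.
    exact: ltW.
  have := @tsum_telescope _ _ h cz; rewrite expr0 mul1r => <-.
  apply: eq_tsum => m; rewrite nsqZ abs2M sE exprS.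
  have -> : abs2 (c ^+ m) = abs2 c ^+ m.
    elim: m => [|m IHm]; first by rewrite !expr0 /abs2 /=; ring.
    by rewrite !exprS abs2M IHm.
  by rewrite mulrBl mul1r mulrBl.
have [||J JE] := @l2_lift R int K K F.
- move=> a x y [m|m] /=; last by rewrite scaler0 addr0.
  by rewrite scalerDr !scalerA mulrC.
- by move=> z; rewrite nF ltry.
have nJ z : nsq (J z) = nsq z.
  by apply: nsq_l2E; rewrite -nF; apply: eq_tsum => n; rewrite JE.
pose rho' (f : l2H int K) (x : H) := exists z, rho z x /\
  forall m : nat, l2v f m = (s * c ^+ m) *: z.
exists (J \o V), rho'; split; first split.
- move=> x; exists (V x); split; first exact: Vx.
  by move=> m; rewrite (JE (V x)).
- move=> a f x [z [zx fz]]; exists (a *: z); split; first exact: Va.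
  by move=> m; rewrite l2vZ fz !scalerA mulrC.
- move=> f x y [z [zx fz]]; apply: etrans (Vip _ _ y zx).
  apply: etrans (ip_polar (f := J) (g := idfun) nJ z (V y)).
  apply: (@eq_l2dot _ _ _ f (J (V y)) (J z) (J (V y))).
  case=> m; first by rewrite (fz m) (JE z).
  by rewrite (JE (V y)) !ip0r.
(* The exponent a counts shifts: a = 1 attaches the scalar c to W, while a = 0 carries W over
   unchanged to the same space. *)
move=> W a Wu; have [W' [WK W'K W'u W'E]] := unitary_inv Wu.
have WE := unitary_nsq Wu.
have [||||U Uu UE] := @l2_unitary R int K
    (fun f n => W (f (n + a))) (fun f n => W' (f (n - a%:Z))).
- by move=> k f g n; rewrite linearP.
- move=> f; apply: etrans (tsum_shift (fun n => nsq (f n)) a).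
  by apply: eq_tsum => n; rewrite WE.
- by move=> f n; rewrite addrK W'K.
- by move=> f n; rewrite subrK WK.
exists U; split=> // T WT f x [z [zx fz]]; exists (c ^+ a *: W z); split.
  by apply: Va; apply: WT.
move=> m; rewrite UE -PoszD fz linearZ scalerA exprD mulrA.
by [].
Qed.

(** The perpendicular at c to the line through 0 and c meets the unit circle in c (1 + i s) and c (1
    - i s), where 1 + s^2 = 1 / |c|^2. *)
Lemma mean_unimodular (c : R[i]) : c != 0 -> abs2 c <= 1 ->
  {ag : R[i] * R[i] | [/\ abs2 ag.1 = 1, abs2 ag.2 = 1 & ag.1 + ag.2 = 2 * c]}.
Proof.
move=> c0 c1; have n0 : abs2 c != 0 by apply: contra_neq c0; exact: abs2_eq0.
have np : 0 < abs2 c by rewrite lt_neqAle eq_sym n0 abs2_ge0.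
pose s := Num.sqrt ((1 - abs2 c) / abs2 c).
have sE : s ^+ 2 = (1 - abs2 c) / abs2 c.
  by rewrite sqr_sqrtr// divr_ge0 ?abs2_ge0 ?subr_ge0.
exists (c * Complex 1 s, c * Complex 1 (- s)); split=> /=.
- by rewrite abs2M {2}/abs2 /= sE; field.
- by rewrite abs2M {2}/abs2 /= sqrrN sE; field.
- by apply: eqC; rewrite !ReImE /=; ring.
Qed.

(** One space serves all the scalars c at once. Each U for c E multiplies the two branches by
    unimodular numbers of mean c, which spoils their equality but puts both in the range of E, hence
    in its kernel. An S anti-commuting with E preserves that kernel. *)
Lemma phase_dilation (H K : hilbert R) (V : {linear H -> K}) rho
    (E : operator H) :
  compression V rho -> (forall x, E (E x) = 0) ->
  exists (V' : {linear H -> l2H bool K}) (rho' : l2H bool K -> H -> Prop),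
    [/\ compression V' rho',
      forall (W : operator K) (S : operator H), unitary_op W -> lifts rho W S ->
        (forall x, S (E x) = - E (S x)) ->
        exists U : operator (l2H bool K), [/\ unitary_op U, lifts rho' U S &
          forall f b, l2v (U f) b = W (l2v f b)] &
      forall (W : operator K) (c : R[i]), unitary_op W -> lifts rho W E ->
        c != 0 -> abs2 c <= 1 ->
        exists (U : operator (l2H bool K)) (th : bool -> R[i]),
          [/\ unitary_op U, lifts rho' U (fun x => c *: E x) &
          forall f b, l2v (U f) b = th b *: W (l2v f b)]].
Proof.
move=> [Vx Va Vip] EE; pose s : R[i] := (Num.sqrt 2)^-1%:C%C.
have sE : abs2 s = 2^-1 by rewrite abs2_real exprVn sqr_sqrtr.
have [|J JE] := @mk_linear R K (l2H bool K) (fun z => bfun (fun _ => s *: z)).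
  by move=> a x y; apply: l2_inj => b /=; rewrite scalerDr !scalerA mulrC.
(* The two branches of [f] represent [xs true] and [xs false], whose mean is [x]; they
   may only differ once [E] kills both of them. *)
pose rho' (f : l2H bool K) (x : H) := exists xs : bool -> H,
  [/\ forall b, exists z, rho z (xs b) /\ l2v f b = s *: z,
      xs true + xs false = (2 : R[i]) *: x &
      xs true = xs false \/ forall b, E (xs b) = 0].
have nJ z : nsq (J z) = nsq z.
  by rewrite JE nsq_bool /= nsqZ sE; field.
exists (J \o V), rho'; split; first split.
- move=> x; exists (fun=> x); split; last by left.
    by move=> b; exists (V x); split; [exact: Vx|rewrite /= JE].
  by rewrite -[X in X + X = _]scale1r -scalerDl.
- move=> a f x [xs [fz xE xD]]; exists (fun b => a *: xs b); split.
  + move=> b; have [z [zx fb]] := fz b; exists (a *: z); split; first exact: Va.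
    by rewrite l2vZ fb !scalerA mulrC.
  + by rewrite -scalerDr xE !scalerA mulrC.
  + by case: xD => [->|xD]; [left|right=> b; rewrite linearZ /= xD scaler0].
- move=> f x y [xs [fz xE _]].
  have h b : ip (l2v f b) (s *: V y) = (2^-1)%:C%C * ip (xs b) y.
    by have [z [zx ->]] := fz b; rewrite ipZl ipZr (Vip _ _ _ zx) mulrA abs2E sE.
  apply: (etrans (ip_bool f (J (V y)))).
  rewrite (JE (V y)) /= !h -mulrDr -ipDl xE ipZl mulrA.
  rewrite (_ : _ * 2 = 1) ?mul1r//.
  by apply: eqC; rewrite !ReImE /=; field.
- move=> W S Wu WS SE; have [W' [WK W'K W'u W'E]] := unitary_inv Wu.
  have [||||U Uu UE] := @l2_unitary R bool K (fun f b => W (f b)) (fun f b => W' (f b)).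
  + by move=> k f g n; rewrite linearP.
  + by move=> f; apply: eq_tsum => b; rewrite (unitary_nsq Wu).
  + by move=> f b; rewrite W'K.
  + by move=> f b; rewrite WK.
  exists U; split=> // f x [xs [fz xE xD]]; exists (fun b => S (xs b)); split.
  + move=> b; have [z [zx fb]] := fz b; exists (W z); split; first exact: WS.
    by rewrite UE fb linearZ.
  + by rewrite -linearD xE linearZ.
  + case: xD => [->|xD]; [by left|right=> b].
    by rewrite -[LHS]opprK -SE xD linear0 oppr0.
- move=> W c Wu WE c0 c1; have [[a g] /= [a1 g1 agE]] := mean_unimodular c0 c1.
  have [W' [WK W'K W'u W'E]] := unitary_inv Wu.
  pose th (b : bool) := if b then a else g.
  have th1 b : abs2 (th b) = 1 by case: b.
  have th0 b : th b != 0.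
    apply/eqP => t0; have := th1 b; rewrite t0 /abs2 /= expr0n addr0 => /eqP.
    by rewrite eq_sym oner_eq0.
  have [||||U Uu UE] := @l2_unitary R bool K (fun f b => th b *: W (f b))
    (fun f b => (th b)^-1 *: W' (f b)).
  + by move=> k f h b; rewrite linearP scalerDr !scalerA mulrC.
  + by move=> f; apply: eq_tsum => b; rewrite nsqZ th1 mul1r (unitary_nsq Wu).
  + by move=> f b; rewrite linearZ /= W'K scalerA divff// scale1r.
  + by move=> f b; rewrite linearZ /= WK scalerA mulVf// scale1r.
  exists U, th; split=> // f x [xs [fz xE xD]]; exists (fun b => th b *: E (xs b)); split.
  + move=> b; have [z [zx fb]] := fz b; exists (th b *: W z); split.
      by apply: Va; apply: WE.
    by rewrite UE fb linearZ /= !scalerA mulrC.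
  + case: xD => [xD|xD]; last first.
      rewrite !xD !scaler0 addr0; have : E (xs true + xs false) = 0 by rewrite linearD !xD addr0.
      rewrite xE linearZ /= => h; by rewrite scalerA mulrC -scalerA h scaler0.
    rewrite xD -scalerDl agE -scalerA; congr (_ *: (_ *: E _)).
    apply: (scalerI (_ : (2 : R[i]) != 0)); first by rewrite pnatr_eq0.
    by rewrite -xE xD -[X in _ = X + X]scale1r -scalerDl.
  + by right=> b; rewrite linearZ /= EE scaler0.
Qed.
End Dilations.

(** * Families of anti-commuting contractions *)

Section Families.
Variable R : realType.
Notation C2 := (C2 R).

Lemma anti_neq (H : hilbert R) (k : nat) (T : 'I_k -> operator H) :
  anti_commuting T -> forall i j, i != j -> forall x, T i (T j x) = - T j (T i x).
Proof.
move=> aT i j; rewrite -val_eqE neq_ltn => /orP[|] h x; first exact: aT.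
by rewrite (aT _ _ h) opprK.
Qed.

Lemma anti_q_commuting (K : hilbert R) (k : nat) (U : 'I_k -> operator K) :
  anti_commuting U -> exists q : 'I_k -> 'I_k -> R[i], sign_family q /\ q_commuting q U.
Proof.
move=> aU; exists (fun _ _ => -1); split; first by right.
split=> [i j _|i j ij x]; last by rewrite scaleN1r aU.
by rewrite normrN1 invrN invr1.
Qed.

Lemma small_family_dilation (k : nat) (T : 'I_k -> operator C2) :
  (1 <= k)%N -> (k <= 2)%N -> (forall i, contraction_op (T i)) -> anti_commuting T ->
  exists (K : hilbert R) (U : 'I_k -> operator K),
    [/\ anti_commuting U, (forall i, unitary_op (U i)) & dilates U T].
Proof.
case: k T => [//|k] T _ k2 cT aT.
have [S [cS aS ST]] : exists S : operator C2, [/\ forall x, nsq (S x) <= nsq x,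
    anti (T ord0) S & forall i, i != ord0 -> T i = S].
  case: k T k2 cT aT => [|[|//]] T _ cT aT.
    exists \0; split=> [x|x|i]; first by rewrite nsq0 nsq_ge0.
      by rewrite /= linear0 oppr0.
    by rewrite ord1.
  exists (T ord_max); split; [exact: contraction_nsq|exact: anti_neq|].
  by move=> i i0; congr T; apply/val_inj; case: i i0 => -[|[|[]]].
have [K [V [rho [W1 [W2 [cV l1 l2 [u1 u2] W12]]]]]] :=
  anti_pair_dilation (contraction_nsq (cT ord0)) cS aS.
exists K, (fun i => if i == ord0 then W1 else W2); split.
- move=> i j ij x; have j0 : j != ord0 by apply: contraTneq ij => ->.
  rewrite (negbTE j0); case: eqP => [_|/eqP i0]; first exact: W12.
  have ip : (0 < i)%N by rewrite lt0n.
  by have := leq_ltn_trans (leq_ltn_trans ip ij) (leq_trans (ltn_ord j) k2); rewrite ltnn.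
- by move=> i; case: ifP.
- apply: compression_dilates cV _ => i; case: eqP => [->//|/eqP i0].
  by rewrite (ST _ i0).
Qed.

Lemma two_others (k : nat) (i : 'I_k) : (2 < k)%N ->
  exists a b : 'I_k, [/\ a != i, b != i & a != b].
Proof.
move=> k3; pose o (n : nat) (h : (n < 3)%N) := Ordinal (leq_trans h k3).
have h0 : (0 < 3)%N by []. have h1 : (1 < 3)%N by []. have h2 : (2 < 3)%N by [].
have [->|i0] := eqVneq i (o 0%N h0); first by exists (o _ h1), (o _ h2).
have [->|i1] := eqVneq i (o 1%N h1); first by exists (o _ h0), (o _ h2).
by exists (o _ h0), (o _ h1); rewrite ![_ == i]eq_sym.
Qed.

Lemma family_traceless (k : nat) (T : 'I_k -> operator C2) : (2 < k)%N ->
  (forall i, nonzero_op (T i)) -> anti_commuting T -> forall i, tr2 (T i) = 0.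
Proof.
move=> k3 nT aT i; have [a [b [ai bi ab]]] := two_others i k3.
apply: (three_anti_traceless (nT a) (nT b)).
- by apply: anti_neq => //; rewrite eq_sym.
- by apply: anti_neq => //; rewrite eq_sym.
- exact: anti_neq.
Qed.

Lemma e1_neq0 : e1 R != 0.
Proof.
apply/eqP => e0; have := fst_e1 R; rewrite e0 /fst2 mxE => /esym/eqP.
by rewrite oner_eq0.
Qed.

Lemma sqr_bij (T : operator C2) (s : R[i]) : s != 0 ->
  (forall x, T (T x) = s *: x) -> bijective T.
Proof.
move=> s0 TT; exists (fun x => s^-1 *: T x) => x; last rewrite linearZ /=.
all: by rewrite TT scalerA mulVf// scale1r.
Qed.

Lemma bij_eq0 (T : operator C2) x : bijective T -> T x = 0 -> x = 0.
Proof. by move=> /bij_inj injT; rewrite -[RHS](linear0 T) => /injT. Qed.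

(** Two sign changes cancel, so Ti commutes with Ta Tb, which is traceless as a product of
    anti-commuting operators. *)
Lemma product_scalar (Ti Ta Tb : operator C2) :
  anti Ti Ta -> anti Ti Tb -> anti Ta Tb -> tr2 Ti = 0 ->
  {t : R[i] | forall x, Ti (Ta (Tb x)) = t *: x}.
Proof.
move=> ia ib ab ti.
apply: (@traceless_comm R Ti (Ta \o Tb) ti (tr2_anti ab)) => x /=.
by rewrite ia ib linearN opprK.
Qed.

Lemma bij_product (Ti Ta Tb : operator C2) :
  anti Ti Ta -> anti Ti Tb -> anti Ta Tb -> tr2 Ti = 0 ->
  bijective Ti -> bijective Ta -> bijective Tb ->
  {c : R[i] | c != 0 & forall x, Ti x = c *: Ta (Tb x)}.
Proof.
move=> ia ib ab ti bi ba bb.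
have [t tE] := product_scalar ia ib ab ti.
have [s sE] := traceless_sqr ti.
have t0 : t != 0.
  apply/eqP => t0; have := e1_neq0; have := tE (e1 R); rewrite t0 scale0r.
  by move=> /(bij_eq0 bi)/(bij_eq0 ba)/(bij_eq0 bb) ->; rewrite eqxx.
have s0 : s != 0.
  apply/eqP => s0; have := e1_neq0; have := sE (e1 R); rewrite s0 scale0r.
  by move=> /(bij_eq0 bi)/(bij_eq0 bi) ->; rewrite eqxx.
(* Ti (Ti (Ta (Tb x))) is s Ta (Tb x) by Ti^2 = s, and t Ti x by the product formula. *)
exists (s / t) => [|x]; first by rewrite mulf_neq0 ?invr_eq0.
have h : s *: Ta (Tb x) = t *: Ti x by rewrite -sE tE linearZ.
by rewrite mulrC -scalerA h scalerA mulVf// scale1r.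
Qed.

(** In a family of four, two members would both be multiples of the product of the other two, hence
    proportional; anti-commutation then forces their squares to be 0. *)
Lemma invertible_family_size (k : nat) (T : 'I_k -> operator C2) :
  (forall i, nonzero_op (T i)) -> anti_commuting T ->
  (forall i, bijective (T i)) -> (k <= 3)%N.
Proof.
move=> nT aT bT; rewrite leqNgt; apply/negP => k4.
have tT := family_traceless (ltnW k4) nT aT.
pose o (n : nat) (h : (n < 4)%N) := Ordinal (leq_trans h k4).
pose a := o 0%N isT; pose b := o 1%N isT; pose i := o 2%N isT; pose j := o 3%N isT.
have an := anti_neq aT.
have [c c0 cE] := bij_product (an i a isT) (an i b isT) (an a b isT) (tT i) (bT i) (bT a) (bT b).
have [d d0 dE] := bij_product (an j a isT) (an j b isT) (an a b isT) (tT j) (bT j) (bT a) (bT b).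
have h x : T i x = (c / d) *: T j x.
  by rewrite cE dE scalerA mulfVK.
have h2 : T j (T j (e1 R)) = 0.
  have := an i j isT (e1 R); rewrite !h linearZ /= => /eqP.
  rewrite -subr_eq0 opprK -scalerDl scaler_eq0 -mulr2n mulrn_eq0 /= mulf_eq0.
  by rewrite invr_eq0 (negbTE c0) (negbTE d0) /= => /eqP.
by have := e1_neq0; rewrite (bij_eq0 (bT j) (bij_eq0 (bT j) h2)) eqxx.
Qed.

Lemma nilpotent_family (k : nat) (T : 'I_k -> operator C2) : (2 < k)%N ->
  (forall i, nonzero_op (T i)) -> anti_commuting T -> (exists i, ~ bijective (T i)) ->
  exists (j m : 'I_k) (c : 'I_k -> R[i]), [/\ m != j, forall x, T m (T m x) = 0 &
    forall i, i != j -> [/\ c i != 0, abs2 (c i) <= 1 & forall x, T i x = c i *: T m x]].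
Proof.
move=> k3 nT aT [n bn]; have tT := family_traceless k3 nT aT.
have an := anti_neq aT.
pose s i := sval (traceless_sqr (tT i)).
have sE i x : T i (T i x) = s i *: x := svalP (traceless_sqr (tT i)) x.
have sn : s n = 0.
  by apply/eqP/negPn/negP => s0; apply: bn; apply: sqr_bij s0 (sE n).
(* At most one square is nonzero. The scalar t = T n T i T j is 0 because T n squares to 0 and T n
   != 0; multiplying by T j T i on the right gives s i s j T n = 0. If all squares vanish, any j
   other than n will do. *)
have [j jn sj] : exists2 j, j != n & forall i, i != j -> s i = 0.
  have [/forallP s0|] := boolP [forall i, s i == 0].
    have [a [_ [an' _ _]]] := two_others n k3; exists a => // i _; exact/eqP.
  rewrite negb_forall => /existsP[j sj]; exists j.
    by apply: contraNneq sj => ->; rewrite sn.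
  move=> i ij; apply/eqP/negPn/negP => si; apply: bn.
  have jn : j != n by apply: contraNneq sj => ->; rewrite sn.
  have i_n : i != n by apply: contraNneq si => ->; rewrite sn.
  have [t tE] := product_scalar (an n i ltac:(by rewrite eq_sym))
    (an n j ltac:(by rewrite eq_sym)) (an i j ij) (tT n).
  have [x Tx] := nT n.
  have t0 : t = 0.
    have := sE n (T i (T j x)); rewrite tE linearZ sn scale0r => /eqP.
    by rewrite scaler_eq0 (negbTE Tx) orbF => /eqP.
  have := tE (T j (T i x)); rewrite t0 scale0r (sE j) !linearZ /= (sE i) linearZ /=.
  by move/eqP; rewrite !scaler_eq0 (negbTE sj) (negbTE si) (negbTE Tx).
have par i : {d : R[i] | i != j -> forall x, T i x = d *: T n x}.
  have [->|i_n] := eqVneq i n; first by exists 1 => _ x; rewrite scale1r.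
  have [_|ij] := eqVneq i j; first by exists 0.
  have nil l : s l = 0 -> forall x, T l (T l x) = 0.
    by move=> sl x; rewrite sE sl scale0r.
  have [d dE] := nilpotent_parallel (nT n) (tT i) (tT n) (nil _ (sj i ij)) (nil _ sn)
    (an i n i_n).
  by exists d.
pose d i := sval (par i).
have dE i : i != j -> forall x, T i x = d i *: T n x := svalP (par i).
have d0 i : i != j -> d i != 0.
  move=> ij; apply/eqP => di; have [x Tx] := nT i; move/eqP: Tx; apply.
  by rewrite dE// di scale0r.
have nj : n != j by rewrite eq_sym.
(* Taking the largest multiple as reference makes every ratio d i / d m of modulus at most 1, as the
   mean of two unimodular numbers must be. *)
pose m := [arg max_(i > n | i != j) abs2 (d i)]%O.
have [mj mmax] : m != j /\ forall i, i != j -> abs2 (d i) <= abs2 (d m).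
  by rewrite /m; case: arg_maxP.
exists j, m, (fun i => d i / d m); split=> //.
  by move=> x; rewrite sE sj// scale0r.
move=> i ij; split.
- by rewrite mulf_neq0 ?invr_eq0 ?d0.
- have e : abs2 (d i / d m) * abs2 (d m) = abs2 (d i) by rewrite -abs2M mulfVK ?d0.
  have p : 0 < abs2 (d m).
    rewrite lt_neqAle abs2_ge0 andbT eq_sym; apply: contra_neq (d0 m mj).
    exact: abs2_eq0.
  by rewrite -(ler_pM2r p) e mul1r mmax.
- by move=> x; rewrite dE// (dE m)// scalerA mulfVK ?d0.
Qed.
End Families.

Section NilpotentFamily.
Variable R : realType.
Notation C2 := (C2 R).

Lemma nilpotent_family_dilation (k : nat) (T : 'I_k -> operator C2) : (2 < k)%N ->
  (forall i, nonzero_op (T i)) -> (forall i, contraction_op (T i)) ->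
  anti_commuting T -> (exists i, ~ bijective (T i)) ->
  exists (K : hilbert R) (q : 'I_k -> 'I_k -> R[i]) (U : 'I_k -> operator K),
    [/\ sign_family q, q_commuting q U, (forall i, unitary_op (U i)) & dilates U T].
Proof.
move=> k3 nT cT aT bT; have an := anti_neq aT.
have [j [m [c [mj mm cE]]]] := nilpotent_family k3 nT aT bT.
have jm : j != m by rewrite eq_sym.
have [K [V [rho [W1 [W2 [cV l1 l2 [u1 u2] W12]]]]]] :=
  anti_pair_dilation (contraction_nsq (cT j)) (contraction_nsq (cT m)) (an j m jm).
have [V' [rho' [cV' dS dE]]] := phase_dilation cV mm.
have /choice[U UE] : forall i, exists U : operator (l2H bool K),
    [/\ unitary_op U, lifts rho' U (T i) &
      if i == j then forall f b, l2v (U f) b = W1 (l2v f b)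
      else exists th : bool -> R[i], forall f b, l2v (U f) b = th b *: W2 (l2v f b)].
  move=> i; case: eqP => [->|/eqP ij].
    have [U [Uu lU UE]] := dS _ _ u1 l1 (an j m jm).
    by exists U.
  have [c0 c1 Ti] := cE i ij; have [U [th [Uu lU UE]]] := dE _ _ u2 l2 c0 c1.
  exists U; split=> //; last by exists th.
  by move=> f x fx; rewrite Ti; exact: lU.
pose q (i l : 'I_k) : R[i] := if (i == j) || (l == j) then -1 else 1.
have UW1 : forall f b, l2v (U j f) b = W1 (l2v f b).
  by have [_ _] := UE j; rewrite eqxx.
exists (l2H bool K), q, U; split.
- by move=> i l _; rewrite /q; case: ifP => _; [right|left].
- split=> [i l _|i l il x].
    by rewrite /q orbC; case: ifP => _; rewrite ?normrN1 ?normr1 ?invrN invr1.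
  have il' : i != l by rewrite neq_ltn il.
  apply: l2_inj => b; rewrite l2vZ /q.
  have [_ _] := UE i; have [_ _] := UE l.
  have [lj|lj] := eqVneq l j; have [ij|ij] := eqVneq i j.
  + by move: il'; rewrite ij lj eqxx.
  + move=> _ [th thE]; rewrite lj UW1 !thE UW1 linearZ /= W12.
    by rewrite scaleN1r scalerN opprK.
  + move=> [th thE] _; rewrite ij UW1 !thE UW1 linearZ /= W12.
    by rewrite scaleN1r scalerN.
  + move=> [th thE] [th' thE']; rewrite scale1r !thE !thE' !thE !linearZ /= !scalerA.
    by rewrite mulrC.
- by move=> i; have [] := UE i.
- by apply: compression_dilates cV' _ => i; have [] := UE i.
Qed.

End NilpotentFamily.

(** * Invertible triples *)

Section Triples.
Variable R : realType.
Notation C2 := (C2 R).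

Lemma ord3P (P : 'I_3 -> Prop) : P 0 -> P 1 -> P 2%:R -> forall i, P i.
Proof.
move=> P0 P1 P2 i.
by case: i => -[|[|[|//]]] h; [move: P0|move: P1|move: P2]; congr P; apply/val_inj.
Qed.

Definition triple (X : Type) (a b c : X) (i : 'I_3) : X :=
  if i == 0 then a else if i == 1 then b else c.

Lemma triple_anti_commuting (K : hilbert R) (A B C : operator K) :
  (forall x, A (B x) = - B (A x)) -> (forall x, A (C x) = - C (A x)) ->
  (forall x, B (C x) = - C (B x)) -> anti_commuting (triple A B C).
Proof. by move=> AB AC BC; apply: ord3P; apply: ord3P. Qed.

Section Triple.
Variables (T : 'I_3 -> operator C2) (c : R[i]).
Hypotheses (cT : forall i, contraction_op (T i)) (aT : anti_commuting T).
Hypotheses (c0 : c != 0) (cE : forall x, T 0 x = c *: T 1 (T 2%:R x)).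

Lemma triple_pair : pair_dilation (T 1) (T 2%:R).
Proof.
by apply: anti_pair_dilation; [exact: contraction_nsq|exact: contraction_nsq|exact: aT].
Qed.

(** No bound on c is required: W1 W2 is unitary, anti-commutes with both factors and represents T 1
    T 2, while c stays outside as the scalar beta. *)
Lemma triple_scaled_dilation :
  exists (K : hilbert R) (U : 'I_3 -> operator K),
    [/\ anti_commuting U, (forall i, unitary_op (U i)) & dilates (scale_first c U) T].
Proof.
have [K [V [rho [W1 [W2 [cV l1 l2 [u1 u2] W12]]]]]] := triple_pair.
pose A : operator K := W1 \o W2.
exists K, (triple A W1 W2); split.
- apply: triple_anti_commuting => // x; rewrite /A /=; first by rewrite [in RHS]W12 linearN opprK.
  by rewrite W12.
- by apply: ord3P => //; exact: (unitary_comp u1 u2).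
- apply: (compression_dilates cV); apply: ord3P => // f x fx.
  rewrite cE; have [_ Va _] := cV; apply: Va.
  by apply: l1; apply: l2.
Qed.

Lemma triple_contractive_dilation : abs2 c <= 1 ->
  exists (K : hilbert R) (U : 'I_3 -> operator K),
    [/\ anti_commuting U, (forall i, unitary_op (U i)) & dilates U T].
Proof.
move=> c1.
have [K [V [rho [W1 [W2 [cV l1 l2 [u1 u2] W12]]]]]] := triple_pair.
pose W : operator K := W1 \o W2.
have u12 : unitary_op W by exact: (unitary_comp u1 u2).
have l12 : lifts rho W (T 1 \o T 2%:R) by move=> f x fx; apply: l1; apply: l2.
(* A unimodular c is absorbed into the unitary; the geometric sequence behind [scalar_dilation] is
   square-summable only for |c| < 1. *)
have [c1'|c1'] := eqVneq (abs2 c) 1.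
  pose A : operator K := c \*: W.
  have [W' [WK W'K _ _]] := unitary_inv u12.
  exists K, (triple A W1 W2); split.
  - apply: triple_anti_commuting => // x; rewrite /A /=.
      by rewrite [in RHS]linearZ /= [in RHS]W12 linearN scalerN opprK.
    by rewrite W12 linearZ /= scalerN.
  - apply: ord3P => //; apply: (@unitary_opP _ _ A (c^-1 \*: W')) => x.
    + by transitivity (nsq (c *: W x)) => //; rewrite nsqZ c1' mul1r (unitary_nsq u12).
    + by transitivity (W' (W x)) => //; rewrite /= linearZ /= scalerA mulVf// scale1r.
    + transitivity (W (W' x)) => //.
      transitivity (c *: W (c^-1 *: W' x)) => //.
      by rewrite linearZ /= scalerA divff// scale1r.
  - apply: (compression_dilates cV); apply: ord3P => // f x fx.
    by rewrite cE; have [_ Va _] := cV; apply: Va; apply: l12.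
have cl : abs2 c < 1 by rewrite lt_neqAle c1'.
have [V' [rho' [cV' sd]]] := scalar_dilation cV cl.
have [U0 [U0u U0E lU0]] := sd W 1%N u12.
have [U1 [U1u U1E lU1]] := sd _ 0%N u1.
have [U2 [U2u U2E lU2]] := sd _ 0%N u2.
exists (l2H int K), (triple U0 U1 U2); split.
- apply: triple_anti_commuting => x; apply: l2_inj => n.
  + rewrite U0E U1E -[RHS]/(- l2v (U1 (U0 x)) n) U1E U0E /= !addr0.
    by rewrite [in RHS]W12 linearN opprK.
  + by rewrite U0E U2E -[RHS]/(- l2v (U2 (U0 x)) n) U2E U0E /= !addr0 W12.
  + by rewrite U1E U2E -[RHS]/(- l2v (U2 (U1 x)) n) U2E U1E /= !addr0 W12.
- exact: ord3P.
- apply: (compression_dilates cV'); apply: ord3P => f x fx.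
  + by rewrite cE; have := lU0 (T 1 \o T 2%:R) l12 f x fx; rewrite expr1.
  + by have := lU1 _ l1 f x fx; rewrite expr0 scale1r.
  + by have := lU2 _ l2 f x fx; rewrite expr0 scale1r.
Qed.
End Triple.

(** If |c| > 1, the norm of S = c P exceeds that of P, unless the latter is 0 or infinite; the
    hypotheses on P exclude these two cases. *)
Lemma opnorm_ratio (S P : C2 -> C2) (c : R[i]) :
  (opnorm P < +oo)%E -> P 0 = 0 -> (exists2 x, nsq x <= 1 & P x != 0) ->
  (forall x, S x = c *: P x) -> (opnorm S <= opnorm P)%E -> abs2 c <= 1.
Proof.
move=> cP P00 [x x1 Px] SE le; rewrite leNgt; apply/negP => c1.
have n0 y (y1 : hnorm y <= 1) := opnorm_ge P y1.
have P0 : (0 <= opnorm P)%E.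
  have h0 : hnorm (0 : C2) <= 1 by rewrite hnormE nsq0 sqrtr0.
  by have := n0 0 h0; rewrite P00 hnormE nsq0 sqrtr0.
pose s := fine (opnorm P).
have sE : opnorm P = s%:E by rewrite fineK// ge0_fin_numE.
have q1 : 1 < Num.sqrt (abs2 c) by rewrite -sqrtr1 ltr_sqrt// (lt_trans ltr01).
have q0 : 0 < Num.sqrt (abs2 c) := lt_trans ltr01 q1.
have h : s <= s / Num.sqrt (abs2 c).
  rewrite -lee_fin -sE; apply: ge_ereal_sup => _ [y y1 <-].
  rewrite lee_fin ler_pdivlMr// -lee_fin -sE; apply: le_trans le.
  suff <- : hnorm (S y) = hnorm (P y) * Num.sqrt (abs2 c) by exact: opnorm_ge.
  by rewrite SE (hnormE (P y)) (hnormE (c *: _)) nsqZ sqrtrM ?abs2_ge0// mulrC.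
have s0 : s <= 0.
  rewrite leNgt; apply/negP => sp.
  by move: h; rewrite ler_pdivlMr// leNgt ltr_pMr// q1.
have hx : hnorm x <= 1 by rewrite hnormE -sqrtr1 ler_sqrt.
have := n0 x hx; rewrite sE lee_fin => /le_trans/(_ s0).
rewrite hnormE => Pn; have : Num.sqrt (nsq (P x)) == 0 by rewrite eq_le Pn sqrtr_ge0.
rewrite sqrtr_eq0 => P1; move/eqP: Px; apply; apply: nsq_eq0; apply/eqP.
by rewrite eq_le P1 nsq_ge0.
Qed.
End Triples.

Theorem theorem2p8 (R : realType) (k : nat) (T : 'I_k -> operator (C2 R)) :
  (1 <= k)%N ->
  (forall i : 'I_k, nonzero_op (T i)) ->
  (forall i : 'I_k, contraction_op (T i)) ->
  anti_commuting T ->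
  [/\ exists (K : hilbert R) (q : 'I_k -> 'I_k -> R[i])
             (U : 'I_k -> operator K) (beta : R[i]),
        [/\ sign_family q, q_commuting q U, (forall i : 'I_k, unitary_op (U i)),
            beta != 0 & dilates (scale_first beta U) T],
      (exists i : 'I_k,
         [/\ nonzero_op (T i), contraction_op (T i) & ~ bijective (T i)]) ->
      exists (K : hilbert R) (q : 'I_k -> 'I_k -> R[i])
             (U : 'I_k -> operator K),
        [/\ sign_family q, q_commuting q U, (forall i : 'I_k, unitary_op (U i))
          & dilates U T]
    & (forall i : 'I_k, bijective (T i)) ->
      (k <= 3)%N /\
      (forall hk : k = 3%N,
         let T' (i : 'I_3) := T (cast_ord (esym hk) i) in
         (opnorm (T' 0%R) <= opnorm (T' 1%R \o T' 2%:R%R))%E ->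
         exists (K : hilbert R) (U : 'I_k -> operator K),
           [/\ anti_commuting U, (forall i : 'I_k, unitary_op (U i))
             & dilates U T])].
Proof.
move=> k1 nT cT aT.
(* Stated over 'I_3, where 0, 1 and 2 are available as indices; it applies to T itself once k has
   been replaced by 3. *)
have ratio (T3 : 'I_3 -> operator (C2 R)) : (forall i, nonzero_op (T3 i)) ->
    anti_commuting T3 -> (forall i, bijective (T3 i)) ->
    {c : R[i] | c != 0 & forall x, T3 0 x = c *: T3 1 (T3 2%:R x)}.
  move=> nT3 aT3 bT3; have an := anti_neq aT3.
  have t0 := @family_traceless R 3 T3 isT nT3 aT3 0.
  exact: (bij_product (an 0 1 isT) (an 0 2%:R isT) (an 1 2%:R isT) t0).
have part1 : (exists i, ~ bijective (T i)) -> exists (K : hilbert R)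
    (q : 'I_k -> 'I_k -> R[i]) (U : 'I_k -> operator K),
    [/\ sign_family q, q_commuting q U, (forall i, unitary_op (U i)) & dilates U T].
  move=> sT; have [k2|k3] := leqP k 2; last exact: nilpotent_family_dilation.
  have [K [U [aU uU dU]]] := small_family_dilation k1 k2 cT aT.
  by have [q [sq qU]] := anti_q_commuting aU; exists K, q, U.
have dil1 (K : hilbert R) (U : 'I_k -> operator K) :
    dilates U T -> dilates (scale_first 1 U) T.
  move=> [V [W [iV adj dE]]]; exists V, W; split=> // m x; rewrite dE; congr (W _).
  rewrite /op_monomial; apply: (big_rec2 (fun F G : K -> K => F (V x) = G (V x))) => //.
  move=> i F G _ /= ->; apply: eq_iter => y.
  by rewrite /scale_first; case: ifP => //=; rewrite scale1r.
split.
- have [sT|bT] := pselect (exists i, ~ bijective (T i)).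
    have [K [q [U [sq qU uU dU]]]] := part1 sT.
    by exists K, q, U, 1; split=> //; exact: dil1.
  have {}bT i : bijective (T i) by apply: contrapT => h; apply: bT; exists i.
  have [k2|k3] := leqP k 2.
    have [K [U [aU uU dU]]] := small_family_dilation k1 k2 cT aT.
    have [q [sq qU]] := anti_q_commuting aU.
    by exists K, q, U, 1; split=> //; exact: dil1.
  have ke : k = 3%N by apply/eqP; rewrite eqn_leq k3 (invertible_family_size nT aT bT).
  subst k; have [c c0 cE] := ratio T nT aT bT.
  have [K [U [aU uU dU]]] := triple_scaled_dilation cT aT cE.
  by have [q [sq qU]] := anti_q_commuting aU; exists K, q, U, c.
- by move=> [i [_ _ bi]]; apply: part1; exists i.
- move=> bT; split=> [|hk]; first exact: invertible_family_size nT aT bT.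
  subst k; move=> T'; have castE i : T' i = T i by rewrite /T' cast_ord_id.
  rewrite !castE => h.
  have [c c0 cE] := ratio T nT aT bT.
  apply: (triple_contractive_dilation cT aT c0 cE).
  have c12 x : nsq (T 1 (T 2%:R x)) <= nsq x.
    by apply: le_trans (contraction_nsq (cT 1) _) (contraction_nsq (cT 2%:R) _).
  apply: (@opnorm_ratio R (T 0) (T 1 \o T 2%:R) c _ _ _ cE h).
  + apply: (@le_lt_trans _ _ 1%E); last exact: ltry.
    apply: ge_ereal_sup => _ [x x1 <-]; rewrite lee_fin; apply: le_trans x1.
    by rewrite /hnorm /dot_norm; apply: ler_wsqrtr; exact: c12.
  + by rewrite /= !linear0.
  + exists (e1 R).
      by rewrite nsq_C2 fst_e1 snd_e1 /abs2 /= !expr0n /= !addr0 expr1n.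
    by apply/eqP => /(bij_eq0 (bT 1))/(bij_eq0 (bT 2%:R))/eqP; apply/negP; exact: e1_neq0.
Qed.
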